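(* Let $T>0$ and let $u\in C^3([0,1]\times[0,T])$ solve the heat equation $$u_t=u_{xx}\quad(0\le x\le 1),\qquad u(x,0)=u_0(x),\qquad u(0,t)=u(1,t)=0 .$$ Let $u^m$ be the crystalline evolution for the heat equation with homogeneous Dirichlet boundary conditions (defined in the context), with compatible initial datum $u_0^m$, and let $m$ be the maximum of $|p_i-p_{i-1}|$ over pairs of consecutive faces of $u_0^m$, where $p_i$ denotes the slope of the $i$-th face ($m=0$ if there is only one face). (1) For all $t\in[0,T]$ outside the finitely many times at which faces of $u^m$ disappear, $$\frac{d}{dt}\,\frac12\int_0^1|u_x-u_x^m|^2\,dx\le-\int_0^1|u_t-u_t^m|^2\,dx+\frac12\,m\,\|u_{xxx}(\cdot,t)\|_{L^\infty([0,1])} .$$ (2) If moreover $\|(u_0^m)_x-(u_0)_x\|_{L^\infty([0,1])}\le m$, then for all $t\in[0,T]$ $$\frac12\int_0^1|u_x-u_x^m|^2\,dx\le\frac12\,m^2+\frac12\,m\int_0^t\|u_{xxx}(\cdot,\tau)\|_{L^\infty([0,1])}\,d\tau .$$ (3) Under the hypothesis of (2), $$\sup_{0\le t\le T}\|u(\cdot,t)-u^m(\cdot,t)\|_{H^1([0,1])}\le c\,m^{1/2},$$ with a constant $c$ depending on $u$ and $T$ but not on $m$.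
   Context: Slope set. $S\subset\mathbb{R}$ is a locally finite set of ''admissible slopes''. Two elements of $S$ are adjacent if they are distinct and no element of $S$ lies strictly between them. Admissible functions. An admissible function is a continuous piecewise linear function on $[0,1]$, made of finitely many linear pieces (''faces''), each with slope in $S$. Its corners have abscissas $0=x_0<x_1<\dots<x_N=1$; face $i$ lies over $(x_{i-1},x_i)$, has projected length $l_i=x_i-x_{i-1}$ and slope $p_i=(u^m_x)_i\in S$. Compatible initial datum. $u_0^m$ is admissible, $u_0^m(0)=u_0^m(1)=0$, and the slopes of any two consecutive faces of $u_0^m$ are adjacent elements of $S$. Crystalline evolution for the heat equation, homogeneous Dirichlet conditions. $u^m(\cdot,t)$ is a family of admissible functions, continuous in $t$, with $u^m(\cdot,0)=u_0^m$. Each face keeps its slope $p_i$ and moves with vertical velocity $v_i=(u^m_t)_i$ (so $u^m_t=v_i$ on face $i$), where $v_1=v_N=0$ and, for $2\le i\le N-1$, $$v_i=\frac{p_{i+1}-p_{i-1}}{2\,l_i}.$$ Since $u^m$ stays continuous, the corners move by $$\dot x_i=-\frac{v_{i+1}-v_i}{p_{i+1}-p_i}\ (1\le i\le N-1),\qquad x_0=0,\ x_N=1,$$ which is a system of ODEs for the lengths $l_i$. When one or more lengths reach zero, the corresponding faces are removed, consecutive remaining faces of equal slope are merged into one face, the faces are renumbered from left to right ($N$ is the current number of faces, and the current first and last faces have zero velocity), and the evolution continues by the same rules. No new faces are ever created.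
   Formalization: In (3) the constant c depends on u, T and an arbitrary upper bound M for m, and the estimate is claimed for all data with m ≤ M; with m unbounded the claim fails (u=0, tent data of slopes A, -A, A large). *)

(* Defs.v *)
From HB Require Import structures.
From mathcomp Require Import all_boot all_order all_algebra.
From mathcomp Require Import all_classical all_reals all_analysis.

Set Implicit Arguments.
Unset Strict Implicit.
Unset Printing Implicit Defensive.

Import Order.TTheory GRing.Theory Num.Theory.
Import numFieldNormedType.Exports.

Local Open Scope classical_set_scope.
Local Open Scope ring_scope.

(* Derivatives relative to a set D: two-sided at interior points of D and
   one-sided at the end points when D is a segment.  [derive_in] is a junk
   value when [derivable_in] fails, e.g. at the corners of a piecewise linear
   function. *)
Definition diff_quotient (R : realType) (f : R -> R) (x y : R) : R :=
  (f y - f x) / (y - x).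

Definition derivable_in (R : realType) (D : set R) (f : R -> R) (x : R) : Prop :=
  cvg (diff_quotient f x y @[y --> within D x^']).

Definition derive_in (R : realType) (D : set R) (f : R -> R) (x : R) : R :=
  lim (diff_quotient f x y @[y --> within D x^']).

(* Functions of (x, t) on the rectangle [0, 1] x [0, T]. *)
Definition dx (R : realType) (u : R -> R -> R) : R -> R -> R :=
  fun x t => derive_in `[0, 1] (u^~ t) x.

Definition dt (R : realType) (T : R) (u : R -> R -> R) : R -> R -> R :=
  fun x t => derive_in `[0, T] (u x) t.

Fixpoint Ck_rect (R : realType) (T : R) (k : nat) (u : R -> R -> R) : Prop :=
  {within `[0, 1]%classic `*` `[0, T]%classic,
    continuous (fun z : R * R => u z.1 z.2)} /\
  match k with
  | 0%N => True
  | k'.+1 =>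
      [/\ forall x t, x \in `[0, 1] -> t \in `[0, T] ->
            derivable_in `[0, 1] (u^~ t) x /\ derivable_in `[0, T] (u x) t,
          Ck_rect T k' (dx u) & Ck_rect T k' (dt T u)]
  end.

Definition heat_solution (R : realType) (T : R) (u0 : R -> R)
    (u : R -> R -> R) : Prop :=
  [/\ forall x t, x \in `[0, 1] -> t \in `[0, T] -> dt T u x t = dx (dx u) x t,
      forall x, x \in `[0, 1] -> u x 0 = u0 x
    & forall t, t \in `[0, T] -> u 0 t = 0 /\ u 1 t = 0].

Definition Linf01 (R : realType) (f : R -> R) : \bar R :=
  ('N[@lebesgue_measure R]_+oo [EFin \o (f \_ `[0%R, 1%R])])%E.

(* For a continuous piecewise C^1 function the weak derivative is the
   pointwise one, which exists off a finite set. *)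
Definition H1norm (R : realType) (f : R -> R) : R :=
  Num.sqrt ((\int[@lebesgue_measure R]_(x in `[0, 1]) `|f x| ^+ 2) +
            (\int[@lebesgue_measure R]_(x in `[0, 1])
               `|derive_in `[0, 1] f x| ^+ 2)).

Definition locally_finite_set (R : realType) (S : set R) : Prop :=
  forall x : R, exists2 U : set R, nbhs x U & finite_set (S `&` U).

Definition adjacent (R : realType) (S : set R) (a b : R) : Prop :=
  [/\ S a, S b, a != b &
      ~ exists c, S c /\ (a < c < b \/ b < c < a)].

(* A polygonal profile on [0, 1] is described by the list, from left to right,
   of the pairs (projected length, slope) of its faces.  Faces are numbered
   from 0; face i lies between the abscissas [corner c i] and
   [corner c i.+1]. *)
Definition faces (R : realType) := seq (R * R).

Definition len (R : realType) (c : faces R) (i : nat) : R := (nth (0, 0) c i).1.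

Definition slope (R : realType) (c : faces R) (i : nat) : R :=
  (nth (0, 0) c i).2.

Definition corner (R : realType) (c : faces R) (i : nat) : R :=
  \sum_(0 <= j < i) len c j.

(* Affinity is required on the closed faces, which overlap at the corners, so
   that w is continuous. *)
Definition has_faces (R : realType) (S : set R) (w : R -> R) (c : faces R) :
    Prop :=
  [/\ forall i, (i < size c)%N -> 0 < len c i /\ S (slope c i),
      corner c (size c) = 1
    & forall i x y, (i < size c)%N ->
        x \in `[corner c i, corner c i.+1] ->
        y \in `[corner c i, corner c i.+1] ->
        w y - w x = slope c i * (y - x)].

Definition compatible (R : realType) (S : set R) (w : R -> R) (c : faces R) :
    Prop :=
  [/\ has_faces S w c, w 0 = 0, w 1 = 0
    & forall i, (i.+1 < size c)%N -> adjacent S (slope c i) (slope c i.+1)].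

Definition max_jump (R : realType) (c : faces R) : R :=
  \big[Num.max/0]_(0 <= i < (size c).-1) `|slope c i.+1 - slope c i|.

Definition velocity (R : realType) (c : faces R) (i : nat) : R :=
  if (0 < i)%N && (i.+1 < size c)%N
  then (slope c i.+1 - slope c i.-1) / (2 * len c i)
  else 0.

(* Speed of [corner c i], the common end of the faces i - 1 and i. *)
Definition corner_speed (R : realType) (c : faces R) (i : nat) : R :=
  - ((velocity c i - velocity c i.-1) / (slope c i - slope c i.-1)).

Fixpoint merge_faces (R : realType) (c : faces R) : faces R :=
  match c with
  | [::] => [::]
  | f :: c' =>
      match merge_faces c' with
      | [::] => [:: f]
      | g :: d =>
          if f.2 == g.2 then (f.1 + g.1, f.2) :: d else [:: f, g & d]
      end
  end.

Definition remove_faces (R : realType) (c : faces R) : faces R :=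
  merge_faces [seq f <- c | f.1 != 0].

(* Motion on [t0, t1] with a fixed list of slopes and positive lengths before
   t1.  At t1 the lengths are only the limits from the left, and some of them
   may be zero. *)
Definition moves (R : realType) (S : set R) (w : R -> R -> R) (t0 t1 : R)
    (c : R -> faces R) : Prop :=
  [/\ forall t, t \in `[t0, t1] ->
        [seq f.2 | f <- c t] = [seq f.2 | f <- c t0],
      forall i, {within `[t0, t1], continuous (fun t => len (c t) i)},
      forall t, t \in `[t0, t1[ -> has_faces S (w^~ t) (c t),
      forall t i x, t \in `]t0, t1[ -> (i < size (c t))%N ->
        x \in `]corner (c t) i, corner (c t) i.+1[ ->
        is_derive t 1 (w x) (velocity (c t) i)
    & forall t i, t \in `]t0, t1[ -> (0 < i < size (c t))%N ->
        is_derive t 1 (fun s => corner (c s) i) (corner_speed (c t) i)].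

(* [flow S T w t0 c es]: on [t0, T] the profiles w(., t) evolve by the
   crystalline law from the faces c at time t0, and es is the list of the
   times in (t0, T] at which faces disappear. *)
Inductive flow (R : realType) (S : set R) (T : R) (w : R -> R -> R) :
    R -> faces R -> seq R -> Prop :=
| flow_last (t0 : R) (c : R -> faces R) :
    t0 <= T ->
    moves S w t0 T c ->
    has_faces S (w^~ T) (c T) ->
    flow S T w t0 (c t0) [::]
| flow_event (t0 t1 : R) (c : R -> faces R) (es : seq R) :
    t0 < t1 ->
    moves S w t0 t1 c ->
    (exists2 i, (i < size (c t1))%N & len (c t1) i = 0) ->
    flow S T w t1 (remove_faces (c t1)) es ->
    flow S T w t0 (c t0) (t1 :: es).

Definition crystalline_evolution (R : realType) (S : set R) (T : R)
    (u0m : R -> R) (c0 : faces R) (um : R -> R -> R) (es : seq R) : Prop :=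
  [/\ forall x, x \in `[0, 1] -> um x 0 = u0m x,
      forall x, x \in `[0, 1] -> {within `[0, T], continuous (um x)}
    & flow S T um 0 c0 es].

Definition energy (R : realType) (u w : R -> R -> R) (t : R) : R :=
  2^-1 * \int[@lebesgue_measure R]_(x in `[0, 1]) `|dx u x t - dx w x t| ^+ 2.

(* Finite when u is C^3 on the rectangle. *)
Definition uxxx_norm (R : realType) (u : R -> R -> R) (t : R) : R :=
  fine (Linf01 ((dx (dx (dx u)))^~ t)).

(* Main.v *)
Require Import Defs.
From HB Require Import structures.
From mathcomp Require Import all_boot all_order all_algebra.
From mathcomp Require Import all_classical all_reals all_analysis.
From mathcomp Require Import measurable_realfun ess_sup_inf.
From mathcomp Require Import lra ring.

Set Implicit Arguments.
Unset Strict Implicit.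
Unset Printing Implicit Defensive.

Import Order.TTheory GRing.Theory Num.Theory.
Import numFieldNormedType.Exports.

Local Open Scope classical_set_scope.
Local Open Scope ring_scope.

(** For a solution [u] of the heat equation and a crystalline evolution [w], with
    faces of lengths l_i, slopes p_i and velocities v_i and corners x_i, write
    E(t) for half the integral of (u_x - w_x)^2.

    Differential inequality. Expanding the square on each face, 2 E is the
    integral of u_x^2 plus the sum over the faces of
    - 2 p_i (u(x_{i+1}, t) - u(x_i, t)) + p_i^2 l_i, so that only the first term
    requires differentiating an integral, and the domain of that one is fixed
    ([dirichlet_der]).  The other terms are differentiated along the corners
    ([has_der_curve]).  Summation by parts ([crystalline_dissipation]) and the laws
    of motion turn the derivative of E into minus the integral of (u_t - w_t)^2
    plus an error: the sum over the inner corners of the jump of slope times the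
    difference between u_t at the corner and the mean of its averages over the two
    adjacent faces, the average over an extreme face being replaced by the boundary
    value 0.  Since u_t = u_xx is Lipschitz in x with constant the norm K of u_xxx,
    each face of length l contributes at most m K l / 2 ([crystalline_error]), and
    the lengths add up to 1.  This is [phase_energy_der].

    Events. The bound uses that no jump of slope exceeds its initial maximum m,
    although faces disappear.  By a maximum principle, the largest speed of an
    inner face does not increase between events: consecutive slopes being adjacent
    in S, an inner face of nonzero speed lies between a smaller and a larger slope,
    and if its speed is the largest then its length does not decrease
    ([fastest_face_grows]).  Hence the lengths of these faces stay bounded below,
    and an inner face can only vanish if its two neighbours have the same slope
    ([moves_zero_inflection]).  In a run of such faces two slopes alternate, so
    that removing the run and merging faces of equal slope leaves only jumps that
    were there before ([remove_faces_chain]).  Faces of length zero do not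
    contribute to E and merging does not change it ([faces_energy_remove]), so E is
    continuous across events and the differential inequality can be integrated by
    induction on the phases ([flow_energy]).

    Sobolev norm. The boundary value w(0, t) stays 0 ([phase_boundary]), and a
    Poincare inequality bounds the H1 norm by the energy ([H1norm_error]). *)

(** * Derivatives relative to a set *)

Section RelativeDerivatives.
Context {R : realType}.
Implicit Types (D : set R) (f g : R -> R) (x l a b : R).

(** [l] is the derivative of [f] at [x] relative to [D], as a first-order expansion
    valid on [D] near [x]; it is one-sided at the ends of a segment [D].  It is not
    required that [x] be a limit point of [D]. *)
Definition has_der D f x l := forall e, 0 < e ->
  \forall y \near within D (nbhs x), `|f y - f x - l * (y - x)| <= e * `|y - x|.

Lemma near_within_dnbhs D x (P : R -> Prop) :
  (\forall y \near within D x^', P y) <->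
  (\forall y \near x, y != x -> D y -> P y).
Proof. by []. Qed.

Lemma has_der_quotientP D f x l :
  has_der D f x l <-> diff_quotient f x y @[y --> within D x^'] --> l.
Proof.
split=> [fl|fl].
- apply/cvgrPdist_le => e e0; apply/near_within_dnbhs.
  have := fl e e0; rewrite near_withinE; apply: filterS => y + yx Dy.
  move=> /(_ Dy); rewrite /diff_quotient.
  have yx0 : y - x != 0 by rewrite subr_eq0.
  have -> : f y - f x - l * (y - x) = ((f y - f x) / (y - x) - l) * (y - x).
    by field.
  by rewrite normrM ler_pM2r ?normr_gt0// distrC.
- move=> e e0; move/cvgrPdist_le: fl => /(_ e e0) /near_within_dnbhs.
  rewrite near_withinE; apply: filterS => y + Dy.
  have [->|yx] := eqVneq y x; first by rewrite !subrr mulr0 subr0 normr0 mulr0.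
  move=> /(_ isT Dy); rewrite /diff_quotient.
  have yx0 : y - x != 0 by rewrite subr_eq0.
  have -> : f y - f x - l * (y - x) = ((f y - f x) / (y - x) - l) * (y - x).
    by field.
  by rewrite normrM ler_pM2r ?normr_gt0// distrC.
Qed.

Lemma within_segment_proper a b x : a < b -> x \in `[a, b] ->
  ProperFilter (within `[a, b]%classic x^').
Proof.
rewrite in_itv /= => ab /andP[ax xb].
apply: Build_ProperFilter_ex => P /near_within_dnbhs /nbhs_ballP[e /= e0 eP].
have [xb'|xb'] := ltP x b.
- pose y := Num.min b (x + e / 2).
  have xy : x < y by rewrite lt_min xb' ltrDl divr_gt0.
  have yb : y <= b by rewrite ge_min lexx.
  have yx : y <= x + e / 2 by rewrite ge_min lexx orbT.
  exists y; apply: eP => /=.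
  + by rewrite /ball /= ltr0_norm ?subr_lt0//; lra.
  + by rewrite gt_eqF.
  + by rewrite in_itv /= yb andbT; lra.
- have a_x : a < x by apply: lt_le_trans xb'.
  pose y := Num.max a (x - e / 2).
  have xy : y < x by rewrite gt_max a_x gtrBl divr_gt0.
  have ya : a <= y by rewrite le_max lexx.
  have yx : x - e / 2 <= y by rewrite le_max lexx orbT.
  exists y; apply: eP => /=.
  + by rewrite /ball /= gtr0_norm ?subr_gt0//; lra.
  + by rewrite lt_eqF.
  + by rewrite in_itv /= ya /=; lra.
Qed.

Lemma has_der_derive_in a b f x l : a < b -> x \in `[a, b] ->
  has_der `[a, b] f x l ->
  derivable_in `[a, b] f x /\ derive_in `[a, b] f x = l.
Proof.
move=> ab xab /has_der_quotientP fl; split; first by apply/cvg_ex; exists l.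
have PF := within_segment_proper ab xab.
exact: (cvg_lim (@Rhausdorff R) fl).
Qed.

Lemma derivable_in_has_der D f x :
  derivable_in D f x -> has_der D f x (derive_in D f x).
Proof. by move=> fx; apply/has_der_quotientP. Qed.

Lemma has_der_near D D' f x l : (\forall y \near x, D' y -> D y) ->
  has_der D f x l -> has_der D' f x l.
Proof.
move=> D'D fl e e0; have := fl e e0; rewrite !near_withinE.
apply: filterS2 D'D => y h1 h2 Dy; exact: h2 (h1 Dy).
Qed.

Lemma has_der_sub D D' f x l : D' `<=` D ->
  has_der D f x l -> has_der D' f x l.
Proof.
move=> D'D fl e e0; have := fl e e0; rewrite !near_withinE.
by apply: filterS => y h Dy; apply: h; exact: D'D.
Qed.

Lemma has_der_eq D f g x l : (\forall y \near x, D y -> f y = g y) ->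
  f x = g x -> has_der D f x l -> has_der D g x l.
Proof.
move=> fg fgx fl e e0; have := fl e e0; rewrite !near_withinE.
by apply: filterS2 fg => y + + Dy => -> //; rewrite fgx; apply.
Qed.

Lemma has_der_is_derive f x l : has_der setT f x l -> is_derive x 1 f l.
Proof.
move=> fl.
have H : (fun h : R => h^-1 *: ((f \o shift x) (h *: 1) - f x)) @ 0^' --> l.
  apply/cvgrPdist_le => e e0; have := fl e e0.
  rewrite near_withinE /dnbhs near_withinE.
  move=> /nbhs_ballP[d /= d0 dP]; apply/nbhs_ballP; exists d => //= h hd h0.
  have := dP (h + x); rewrite /ball /= addrK opprD addrCA subrr addr0.
  move: hd; rewrite /ball /= sub0r => hd /(_ hd I).
  have -> : h%:A = h by rewrite -[RHS]mulr1.
  have -> : f (h + x) - f x - l * h = h * (h^-1 * (f (h + x) - f x) - l).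
    by field.
  by rewrite normrM mulrC ler_pM2r ?normr_gt0// distrC.
split; first by apply/cvg_ex; exists l.
by rewrite /derive; apply: cvg_lim H.
Qed.

Lemma is_derive_has_der D f x l : is_derive x 1 f l -> has_der D f x l.
Proof.
move=> [fx <-]; apply: (@has_der_sub setT) => //.
move=> e e0; move: fx => /cvgrPdist_le /(_ e e0).
rewrite near_withinE /dnbhs near_withinE.
move=> /nbhs_ballP[d /= d0 dP]; apply/nbhs_ballP; exists d => //= y yd _.
have [->|yx] := eqVneq y x; first by rewrite !subrr mulr0 subr0 normr0 mulr0.
have yx0 : y - x != 0 by rewrite subr_eq0.
have := dP (y - x); rewrite /ball /= sub0r opprB => /(_ yd yx0).
have -> : (y - x)%:A = y - x by rewrite -[RHS]mulr1.
rewrite subrK /derive.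
set k := lim _.
have -> : f y - f x - k * (y - x) = (y - x) * ((y - x)^-1 * (f y - f x) - k).
  by field.
by rewrite normrM mulrC ler_pM2r ?normr_gt0// distrC.
Qed.

Lemma has_der_continuous D f x l : has_der D f x l ->
  f y @[y --> within D (nbhs x)] --> f x.
Proof.
move=> fl; apply/cvgrPdist_le => e e0.
have := fl 1 ltr01; rewrite !near_withinE.
have H : \forall y \near x, `|x - y| < e / (1 + `|l|).
  apply/nbhs_ballP; exists (e / (1 + `|l|)) => //=.
  by rewrite divr_gt0 ?ltr_wpDr.
apply: filterS2 H => y yx + Dy; move=> /(_ Dy); rewrite mul1r => fy.
rewrite distrC -[f y - f x](subrK (l * (y - x))) (le_trans (ler_normD _ _))//.
rewrite (le_trans (lerD fy (lexx _)))// normrM -{1}[`|y - x|]mul1r -mulrDl.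
rewrite -ler_pdivlMl ?ltr_wpDr// mulrC distrC ltW//.
Qed.

Lemma has_der_MVT a b f (f' : R -> R) : a < b ->
  {within `[a, b], continuous f} ->
  (forall x, x \in `]a, b[ -> has_der `]a, b[ f x (f' x)) ->
  exists2 c, c \in `]a, b[ & f b - f a = f' c * (b - a).
Proof.
move=> ab fc ff'; apply: MVT => // x xab; apply: has_der_is_derive.
apply: has_der_near (ff' x xab).
by have := near_in_itvoo xab; apply: filterS => y + _; rewrite inE /=.
Qed.

Lemma within_segmentP a b f : {within `[a, b], continuous f} <->
  forall x, x \in `[a, b] -> f y @[y --> within `[a, b] (nbhs x)] --> f x.
Proof. by rewrite subspace_continuousP. Qed.

Lemma within_segmentS a b c d f : a <= c -> d <= b ->
  {within `[a, b], continuous f} -> {within `[c, d], continuous f}.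
Proof.
move=> ac db; apply: continuous_subspaceW => x /=.
by rewrite !in_itv /= => /andP[cx xd]; rewrite (le_trans ac cx) (le_trans xd db).
Qed.

Lemma has_der_segment_continuous a b f (f' : R -> R) :
  (forall x, x \in `[a, b] -> has_der `[a, b] f x (f' x)) ->
  {within `[a, b], continuous f}.
Proof.
by move=> ff'; apply/within_segmentP => x /ff' /has_der_continuous.
Qed.

(** A one-sided derivative is the limit of the interior derivatives. *)
Lemma has_der_closure a b f (f' : R -> R) x :
  {within `[a, b], continuous f} ->
  (\forall y \near x, y \in `]a, b[ -> has_der `]a, b[ f y (f' y)) ->
  x \in `[a, b] -> f' y @[y --> within `[a, b] (nbhs x)] --> f' x ->
  has_der `[a, b] f x (f' x).
Proof.
move=> fc ff' xab /cvgrPdist_le f'x e e0.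
have := f'x e e0; rewrite !near_withinE => f'e.
have [d /= d0 dP] := (nbhs_ballP _ _).1 (filterI ff' f'e).
apply/nbhs_ballP; exists d => //= y yd yab.
move: (xab) (yab); rewrite !in_itv /= => /andP[ax xb] /andP[ay yb].
have near_x c : `|c - x| <= `|y - x| -> ball x d c.
  by move=> cyx; rewrite /ball /= distrC (le_lt_trans cyx) // distrC.
have slope_near c : c \in `]a, b[ -> `|c - x| <= `|y - x| -> `|f' c - f' x| <= e.
  move=> cab cyx; rewrite distrC; have [_] := dP c (near_x c cyx).
  by apply; exact: subset_itv_oo_cc.
have der c : c \in `]a, b[ -> `|c - x| <= `|y - x| -> has_der `]a, b[ f c (f' c).
  by move=> cab cyx; have [+ _] := dP c (near_x c cyx); apply.
have [xy|yx|->] := ltgtP x y.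
- have xyab z : z \in `]x, y[ -> (z \in `]a, b[) /\ (`|z - x| <= `|y - x|).
    rewrite !in_itv /= => /andP[xz zy]; rewrite (le_lt_trans ax xz) (lt_le_trans zy) //.
    by rewrite !gtr0_norm ?subr_gt0 // lerD2r ltW.
  have [|c cxy|c /xyab[cab cyx] fxy] := @has_der_MVT x y f f' xy.
  + exact: within_segmentS fc.
  + have [cab cyx] := xyab c cxy; apply: has_der_sub (der c cab cyx) => z.
    by move=> /xyab[].
  + by rewrite fxy -mulrBl normrM ler_wpM2r // slope_near.
- have yxab z : z \in `]y, x[ -> (z \in `]a, b[) /\ (`|z - x| <= `|y - x|).
    rewrite !in_itv /= => /andP[yz zx]; rewrite (le_lt_trans ay yz) (lt_le_trans zx) //.
    by rewrite !ltr0_norm ?subr_lt0 // lerN2 lerD2r ltW.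
  have [|c cxy|c /yxab[cab cyx] fxy] := @has_der_MVT y x f f' yx.
  + exact: within_segmentS fc.
  + have [cab cyx] := yxab c cxy; apply: has_der_sub (der c cab cyx) => z.
    by move=> /yxab[].
  + have -> : f y - f x - f' x * (y - x) = f' x * (x - y) - (f x - f y) by ring.
    have -> : f' x * (x - y) - (f x - f y) = (f' c - f' x) * (y - x).
      by rewrite fxy; ring.
    by rewrite normrM ler_wpM2r // slope_near.
- by rewrite !subrr mulr0 subr0 normr0 mulr0.
Qed.

Lemma has_der_cst D k x : has_der D (fun=> k) x 0.
Proof.
by move=> e e0; apply: nearW => y; rewrite subrr mul0r subr0 normr0 mulr_ge0 ?normr_ge0 ?(ltW e0).
Qed.

Lemma has_der_id D x : has_der D id x 1.
Proof.
by move=> e e0; apply: nearW => y; rewrite mul1r subrr normr0 mulr_ge0 ?normr_ge0 ?(ltW e0).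
Qed.

Lemma has_derD D f g x l k : has_der D f x l -> has_der D g x k ->
  has_der D (fun y => f y + g y) x (l + k).
Proof.
move=> fl gk e e0; have e20 : 0 < e / 2 by rewrite divr_gt0.
apply: filterS2 (fl _ e20) (gk _ e20) => y fy gy.
have -> : f y + g y - (f x + g x) - (l + k) * (y - x) =
  (f y - f x - l * (y - x)) + (g y - g x - k * (y - x)) by ring.
rewrite (le_trans (ler_normD _ _))// (le_trans (lerD fy gy))// -mulrDl.
by rewrite -splitr.
Qed.

Lemma has_derZ D f x l k : has_der D f x l ->
  has_der D (fun y => k * f y) x (k * l).
Proof.
move=> fl e e0; have k0 : 0 < 1 + `|k| by rewrite ltr_wpDr.
have e20 : 0 < e / (1 + `|k|) by rewrite divr_gt0.
apply: filterS (fl _ e20) => y fy.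
have -> : k * f y - k * f x - k * l * (y - x) =
  k * (f y - f x - l * (y - x)) by ring.
rewrite normrM (le_trans (ler_wpM2l _ fy))//.
rewrite mulrA ler_wpM2r// mulrA ler_pdivrMr// mulrC ler_wpM2l ?ltW//.
by rewrite ltrDr.
Qed.

Lemma has_der_ext D f g x l : (forall y, f y = g y) ->
  has_der D f x l -> has_der D g x l.
Proof. by move=> /funext ->. Qed.

Lemma has_derN D f x l : has_der D f x l -> has_der D (fun y => - f y) x (- l).
Proof.
move=> /(has_derZ (-1)); rewrite mulN1r; apply: has_der_ext => y.
by rewrite mulN1r.
Qed.

Lemma has_derB D f g x l k : has_der D f x l -> has_der D g x k ->
  has_der D (fun y => f y - g y) x (l - k).
Proof. by move=> fl /has_derN; apply: has_derD. Qed.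

Lemma has_der_sum D (n : nat) (F : nat -> R -> R) (L : nat -> R) x :
  (forall i, (i < n)%N -> has_der D (F i) x (L i)) ->
  has_der D (fun y => \sum_(0 <= i < n) F i y) x (\sum_(0 <= i < n) L i).
Proof.
elim: n => [_|n IH FL].
  rewrite [X in has_der _ _ _ X]big_geq//.
  by apply: has_der_ext (has_der_cst D 0 x) => y; rewrite big_geq.
rewrite [X in has_der _ _ _ X]big_nat_recr//=.
have Fn := IH (fun i h => FL i (ltnW h)).
apply: has_der_ext (has_derD Fn (FL n (ltnSn n))) => y.
by rewrite big_nat_recr.
Qed.

Lemma has_derM D f g x l k : has_der D f x l -> has_der D g x k ->
  has_der D (fun y => f y * g y) x (l * g x + f x * k).
Proof.
move=> fl gk.
have [H1 H2] := (has_der_quotientP D f x l, has_der_quotientP D g x k).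
apply/has_der_quotientP.
have W : within D x^' --> within D (nbhs x).
  move=> P DP; have {}DP : \forall y \near x, D y -> P y := DP.
  by apply/near_within_dnbhs; apply: filterS DP => y h _; exact: h.
have gc : g y @[y --> within D x^'] --> g x.
  by apply: cvg_trans (has_der_continuous gk); exact: cvg_app.
have -> : diff_quotient (fun y => f y * g y) x = (fun y =>
    diff_quotient f x y * g y + f x * diff_quotient g x y).
  by apply/funext => y; rewrite /diff_quotient; ring.
by apply: cvgD; apply: cvgM => //; [exact: H1.1|exact: cvg_cst|exact: H2.1].
Qed.

End RelativeDerivatives.

(** * Integrals over segments *)

Section SegmentIntegrals.
Context {R : realType}.
Implicit Types (f g F G : R -> R) (a b c v w : R).
Notation mu := (@lebesgue_measure R).

(** [f] is integrable over the segment [a, b], with [a <= b], and [v] is its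
    integral; the values of [f] at [a] and [b] do not matter. *)
Definition has_int f a b v :=
  [/\ a <= b, mu.-integrable `[a, b] (EFin \o f)
    & \int[mu]_(x in `[a, b]) f x = v].

Lemma has_int_Rintegral f a b v : has_int f a b v ->
  \int[mu]_(x in `[a, b]) f x = v.
Proof. by case. Qed.

Lemma has_int_uniq f a b v w : has_int f a b v -> has_int f a b w -> v = w.
Proof. by move=> [_ _ <-] [_ _ <-]. Qed.

Lemma continuous_has_int f a b : a <= b -> {within `[a, b], continuous f} ->
  has_int f a b (\int[mu]_(x in `[a, b]) f x).
Proof.
move=> ab fc; split=> //.
by apply: continuous_compact_integrable => //; exact: segment_compact.
Qed.

Lemma has_int_ext_oo f g a b v : {in `]a, b[, f =1 g} ->
  has_int g a b v -> has_int f a b v.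
Proof.
move=> fg [ab gi <-].
have mg : measurable_fun `]a, b[ g.
  have /measurable_EFinP mg := measurable_int mu gi.
  by apply: measurable_funS mg => //; exact: subset_itv_oo_cc.
have mf : measurable_fun `]a, b[ f.
  by apply: eq_measurable_fun mg => x; rewrite inE /= => /fg.
have mf' : measurable_fun `[a, b] f.
  exact/measurable_fun_itv_bndo_bndcP/measurable_fun_itv_obnd_cbndP.
split=> //; last first.
  by rewrite /Rintegral; congr fine; apply: eq_integral_itv_bounded.
apply/integrableP; split; first exact/measurable_EFinP.
move/integrableP: gi => [_]; congr (_ < _)%E.
apply/esym; apply: (@eq_integral_itv_bounded _ a b (fun x => `|g x|) (fun x => `|f x|)).
- exact: measurableT_comp.
- exact: measurableT_comp.
- by move=> x /fg /= ->.
Qed.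

Lemma has_int_pt f a : has_int f a a 0.
Proof.
split; rewrite ?lexx ?set_itv1 ?Rintegral_set1//.
by apply: null_set_integrable => //; [exact: measurable_fun_set1|exact: lebesgue_measure_set1].
Qed.

Lemma has_int_ftc g G a b : a <= b ->
  {within `[a, b], continuous g} -> {within `[a, b], continuous G} ->
  (forall x, x \in `]a, b[ -> has_der `]a, b[ G x (g x)) ->
  has_int g a b (G b - G a).
Proof.
rewrite le_eqVlt => /predU1P[-> _ _ _|ab gc Gc dG].
  by rewrite subrr; exact: has_int_pt.
have [_ gi _] := continuous_has_int (ltW ab) gc.
split=> //; first exact: ltW.
have dG' x : x \in `]a, b[ -> is_derive x 1 G (g x).
  move=> xab; apply: has_der_is_derive; apply: has_der_near (dG x xab).
  by have := near_in_itvoo xab; apply: filterS => y + _; rewrite inE.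
rewrite /Rintegral (@continuous_FTC2 R g G)//.
- have [_ Ga Gb] := (continuous_within_itvP G ab).1 Gc.
  by split=> // x xab; have [] := dG' x xab.
- move=> x xab; rewrite derive1E; exact: (@derive_val _ _ _ _ _ _ _ (dG' x xab)).
Qed.

Lemma has_int_cat f a b c v w :
  has_int f a b v -> has_int f b c w -> has_int f a c (v + w).
Proof.
move=> [ab iab <-] [bc ibc <-].
have E : `[a, c]%classic = `[a, b]%classic `|` `]b, c]%classic.
  by rewrite -itv_bndbnd_setU ?bnd_simp.
have ibc' : mu.-integrable `]b, c] (EFin \o f).
  by apply: integrableS ibc => //; exact: subset_itv_oc_cc.
have D : [disjoint `[a, b]%classic & `]b, c]%classic].
  apply/disj_setPS => y [/=]; rewrite !in_itv/= => /andP[_ yb] /andP[].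
  by rewrite ltNge yb.
have iac : mu.-integrable `[a, c] (EFin \o f).
  move/integrableP: iab => [m1 i1]; move/integrableP: ibc' => [m2 i2].
  apply/integrableP; rewrite E; split; first by apply/measurable_funU.
  rewrite ge0_integral_setU//=; first by rewrite lte_add_pinfty.
  by apply/measurable_funU => //; split; apply/measurable_EFinP; apply: measurableT_comp => //; apply/measurable_EFinP.
split=> //; first exact: le_trans bc.
rewrite E Rintegral_setU//=; last by rewrite -E.
by rewrite Rintegral_itv_obnd_cbnd.
Qed.

Lemma has_intD f g a b v w : has_int f a b v -> has_int g a b w ->
  has_int (fun x => f x + g x) a b (v + w).
Proof.
move=> [ab fi <-] [_ gi <-]; split=> //; last exact: RintegralD.
by apply: eq_integrable (integrableD _ fi gi).
Qed.

Lemma has_intZ f a b v k : has_int f a b v ->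
  has_int (fun x => k * f x) a b (k * v).
Proof.
move=> [ab fi <-]; split=> //; last exact: RintegralZl.
by apply: eq_integrable (integrableZl _ k fi).
Qed.

Lemma has_intB f g a b v w : has_int f a b v -> has_int g a b w ->
  has_int (fun x => f x - g x) a b (v - w).
Proof.
move=> fi /(has_intZ (-1)) gi; have := has_intD fi gi; rewrite mulN1r.
by apply: has_int_ext_oo => x _; rewrite mulN1r.
Qed.

Lemma has_int_cst k a b : a <= b -> has_int (fun=> k) a b (k * (b - a)).
Proof.
move=> ab; rewrite mulrBr; apply: (@has_int_ftc _ (fun x => k * x)) => //.
- exact/continuous_subspaceT/cst_continuous.
- by apply: continuous_subspaceT => x; apply: cvgM; [exact: cvg_cst|exact: cvg_id].
- move=> x _; rewrite -[X in has_der _ _ _ X]mulr1.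
  exact: has_derZ (has_der_id _ _).
Qed.

Lemma has_int_le f g a b v w : has_int f a b v -> has_int g a b w ->
  {in `]a, b[, forall x, f x <= g x} -> v <= w.
Proof.
move=> fi gi fg.
pose h x := Num.max (f x) (g x).
have hi : has_int h a b w.
  by apply: has_int_ext_oo gi => x /fg; rewrite /h => /max_idPr.
move: fi hi => [ab fi <-] [_ hi <-]; apply: le_Rintegral => // x _.
by rewrite le_max lexx.
Qed.

End SegmentIntegrals.

(** * Polygonal profiles *)

Section Faces.
Context {R : realType}.
Implicit Types (S : set R) (w f : R -> R) (c : faces R).

Lemma corner0 c : corner c 0 = 0.
Proof. by rewrite /corner big_geq. Qed.

Lemma cornerS c i : corner c i.+1 = corner c i + len c i.
Proof. by rewrite /corner big_nat_recr. Qed.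

Lemma corner_cons (h : R * R) c i : corner (h :: c) i.+1 = h.1 + corner c i.
Proof. by rewrite /corner big_nat_recl. Qed.

Lemma corner_le S w c i j : has_faces S w c -> (i <= j <= size c)%N ->
  corner c i <= corner c j.
Proof.
move=> [cpos _ _] /andP[]; elim: j => [|j IH]; first by rewrite leqn0 => /eqP ->.
rewrite leq_eqVlt => /predU1P[-> //|]; rewrite ltnS => ij jc.
rewrite (le_trans (IH ij (ltnW jc)))// cornerS lerDl.
by have [/ltW] := cpos j jc.
Qed.

Lemma corner_lt S w c i : has_faces S w c -> (i < size c)%N ->
  corner c i < corner c i.+1.
Proof. by move=> [cpos _ _] ic; rewrite cornerS ltrDl; case: (cpos i ic). Qed.

Lemma corner_itv S w c i : has_faces S w c -> (i <= size c)%N ->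
  corner c i \in `[0, 1].
Proof.
move=> wc ic; have [_ c1 _] := wc; rewrite in_itv /= -(corner0 c) -c1.
by rewrite !(corner_le wc)// ?ic ?leqnn.
Qed.

Lemma face_sub S w c i x : has_faces S w c -> (i < size c)%N ->
  x \in `[corner c i, corner c i.+1] -> x \in `[0, 1].
Proof.
move=> wc ic; have := corner_itv wc ic; have := corner_itv wc (ltnW ic).
rewrite !in_itv /= => /andP[h1 _] /andP[_ h2] /andP[h3 h4].
by rewrite (le_trans h1) // (le_trans h4).
Qed.

Lemma face_sub_oo S w c i x : has_faces S w c -> (i < size c)%N ->
  x \in `]corner c i, corner c i.+1[ -> x \in `]0, 1[.
Proof.
move=> wc ic; have := corner_itv wc ic; have := corner_itv wc (ltnW ic).
rewrite !in_itv /= => /andP[h1 _] /andP[_ h2] /andP[h3 h4].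
by rewrite (le_lt_trans h1) // (lt_le_trans h4).
Qed.

Lemma exists_face S w c x : has_faces S w c -> x \in `[0, 1] ->
  exists2 i, (i < size c)%N & x \in `[corner c i, corner c i.+1].
Proof.
move=> wc; have [_ c1 _] := wc.
have c0 : (0 < size c)%N.
  by case: (c) c1 => //= /esym/eqP; rewrite corner0 oner_eq0.
rewrite in_itv /= => /andP[x0 x1].
have : x <= corner c (size c) by rewrite c1.
elim: (size c) c0 => // n IH _ xn.
have [n0|n0] := posnP n.
  by move: xn; rewrite n0 => xn; exists 0%N; rewrite // in_itv /= corner0 x0.
have [/(IH n0)[i ilt xi]|/ltW nx] := leP x (corner c n).
  by exists i => //; rewrite ltnW.
by exists n => //; rewrite in_itv /= nx.
Qed.

Lemma face_has_der S w c i x (D : set R) : has_faces S w c -> (i < size c)%N ->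
  x \in `]corner c i, corner c i.+1[ -> has_der D w x (slope c i).
Proof.
move=> [_ _ waff] ic xi e e0; rewrite near_withinE.
have := near_in_itvoo xi; apply: filterS => y yi _.
rewrite (waff i x y ic) ?subset_itv_oo_cc// subrr normr0.
by rewrite mulr_ge0 ?normr_ge0 ?(ltW e0).
Qed.

Lemma face_derive_in S w c i x : has_faces S w c -> (i < size c)%N ->
  x \in `]corner c i, corner c i.+1[ -> derive_in `[0, 1] w x = slope c i.
Proof.
move=> wc ic xi; apply: (has_der_derive_in ltr01 _ (face_has_der _ wc ic xi)).2.
by apply: (face_sub wc ic); exact: subset_itv_oo_cc.
Qed.

(** Only the open faces matter to an integral: the integrand is arbitrary at the
    corners. *)
Lemma has_int_faces S w c f (V : nat -> R) n : has_faces S w c ->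
  (n <= size c)%N ->
  (forall i, (i < size c)%N -> has_int f (corner c i) (corner c i.+1) (V i)) ->
  has_int f 0 (corner c n) (\sum_(0 <= i < n) V i).
Proof.
move=> wc + fV; elim: n => [_|n IH nc].
  by rewrite corner0 big_geq//; exact: has_int_pt.
by rewrite big_nat_recr //=; apply: has_int_cat (fV n nc); apply: IH (ltnW nc).
Qed.

Lemma has_int_faces1 S w c f (V : nat -> R) : has_faces S w c ->
  (forall i, (i < size c)%N -> has_int f (corner c i) (corner c i.+1) (V i)) ->
  has_int f 0 1 (\sum_(0 <= i < size c) V i).
Proof.
by move=> wc fV; have := has_int_faces wc (leqnn _) fV; have [_ -> _] := wc.
Qed.

(** [has_primitive Q q]: on [0, 1] the continuous function [Q] is the derivative of [q]. *)
Definition has_primitive (Q q : R -> R) :=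
  [/\ {within `[0, 1], continuous Q}, {within `[0, 1], continuous q}
    & forall x, x \in `]0, 1[ -> has_der `]0, 1[ q x (Q x)].

Lemma primitive_has_int Q q a b k l : has_primitive Q q -> 0 <= a -> a <= b ->
  b <= 1 ->
  has_int (fun x => k * Q x + l) a b (k * (q b - q a) + l * (b - a)).
Proof.
move=> [Qc qc dq] a0 ab b1; apply: has_intD; last exact: has_int_cst.
apply: has_intZ; apply: has_int_ftc => //; try exact: within_segmentS _ _ Qc.
- exact: within_segmentS qc.
- move=> x xab; apply: has_der_sub (dq x _) => [y /=|].
    by rewrite !in_itv /= => /andP[h1 h2]; rewrite (le_lt_trans a0) // (lt_le_trans h2).
  by move: xab; rewrite !in_itv /= => /andP[h1 h2]; rewrite (le_lt_trans a0) // (lt_le_trans h2).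
Qed.

Lemma piecewise_has_int S w c Q q f (al be : nat -> R) : has_faces S w c ->
  has_primitive Q q ->
  (forall i x, (i < size c)%N -> x \in `]corner c i, corner c i.+1[ ->
    f x = al i * Q x + be i) ->
  has_int f 0 1 (\sum_(0 <= i < size c)
     (al i * (q (corner c i.+1) - q (corner c i)) + be i * len c i)).
Proof.
move=> wc Qq fE; apply: (has_int_faces1 wc) => i ic.
have -> : len c i = corner c i.+1 - corner c i by rewrite cornerS addrC addKr.
apply: has_int_ext_oo (primitive_has_int (al i) (be i) Qq _ _ _).
- by move=> x xi; exact: fE.
- by have := corner_itv wc (ltnW ic); rewrite in_itv /= => /andP[].
- exact/ltW/(corner_lt wc).
- by have := corner_itv wc ic; rewrite in_itv /= => /andP[].
Qed.

Lemma has_int_split f (a b c v : R) : a <= b -> b <= c -> has_int f a c v ->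
  exists v1 v2, [/\ has_int f a b v1, has_int f b c v2 & v = v1 + v2].
Proof.
move=> ab bc [ac fi vE].
have [h1 h2] : has_int f a b (\int[@lebesgue_measure R]_(x in `[a, b]) f x) /\
    has_int f b c (\int[@lebesgue_measure R]_(x in `[b, c]) f x).
  split; split=> //; apply: integrableS fi => //.
    by apply: subset_itvl; rewrite bnd_simp.
  by apply: subset_itvr; rewrite bnd_simp.
do 2 eexists; split; [exact: h1|exact: h2|].
by apply: (@has_int_uniq _ f a c) => //; exact: has_int_cat h1 h2.
Qed.

Lemma has_int_ge0 f a b v : has_int f a b v -> {in `]a, b[, forall x, 0 <= f x} ->
  0 <= v.
Proof.
move=> fv f0; have [ab _ _] := fv.
have := has_int_le (has_int_cst 0 ab) fv f0; by rewrite mul0r.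
Qed.

(** The fundamental theorem of calculus for the difference of [q] and a profile. *)
Lemma has_int_slope_defect S w c Q q y : has_faces S w c -> has_primitive Q q ->
  y \in `[0, 1] ->
  has_int (fun x => Q x - derive_in `[0, 1] w x) 0 y ((q y - w y) - (q 0 - w 0)).
Proof.
move=> wc Qq y01; have [i ic yi] := exists_face wc y01.
have [_ _ waff] := wc.
have piece j z : (j < size c)%N -> z \in `[corner c j, corner c j.+1] ->
    has_int (fun x => Q x - derive_in `[0, 1] w x) (corner c j) z
      ((q z - w z) - (q (corner c j) - w (corner c j))).
  move=> jc zj; have := zj; rewrite in_itv /= => /andP[jz zj1].
  have z01 := face_sub wc jc zj; have j01 := corner_itv wc (ltnW jc).
  have -> : (q z - w z) - (q (corner c j) - w (corner c j)) =
      1 * (q z - q (corner c j)) + (- slope c j) * (z - corner c j).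
    have := waff j (corner c j) z jc; rewrite in_itv /= lexx ltW /= ?(corner_lt wc)//.
    by move=> /(_ isT zj) wE; rewrite mulNr -wE; ring.
  apply: has_int_ext_oo (primitive_has_int 1 (- slope c j) Qq _ jz _).
  - move=> x xj; rewrite (face_derive_in wc jc) ?mul1r//.
    move: xj; rewrite !in_itv /= => /andP[-> xz]; exact: lt_le_trans zj1.
  - by move: j01; rewrite in_itv /= => /andP[].
  - by move: z01; rewrite in_itv /= => /andP[].
have whole j : (j < size c)%N -> corner c j.+1 \in `[corner c j, corner c j.+1].
  by move=> jc; rewrite in_itv /= lexx andbT ltW // (corner_lt wc).
have H := has_int_faces wc (ltnW ic) (fun j jc => piece j _ jc (whole j jc)).
have {}H := has_int_cat H (piece i y ic yi).
rewrite (telescope_sumr (fun j => q (corner c j) - w (corner c j)))// in H.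
by rewrite corner0 addrC subrKA in H.
Qed.

End Faces.

(** * Removing and merging faces *)

Section RemovingFaces.
Context {R : realType}.
Implicit Types (c d : faces R) (r : R -> R -> Prop) (h : R * R).

(** Every two consecutive slopes, from left to right, are related by [r]. *)
Definition slope_chain r c := forall i, (i.+1 < size c)%N ->
  r (slope c i) (slope c i.+1).

Lemma slope_chain_cons2 r h1 h2 c : slope_chain r [:: h1, h2 & c] <->
  r h1.2 h2.2 /\ slope_chain r (h2 :: c).
Proof.
split=> [rc|[r12 rc] [|i] //]; last by rewrite ltnS; exact: rc.
by split=> [|i ic]; [exact: (rc 0%N)|exact: (rc i.+1)].
Qed.

Lemma slope_chain_tail r h c : slope_chain r (h :: c) -> slope_chain r c.
Proof. by move=> rc i ic; exact: (rc i.+1). Qed.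

(** The faces of length zero, apart from the first and the last face, lie between
    two faces of equal slopes. *)
Definition zero_inflection c := forall i, (0 < i)%N -> (i.+1 < size c)%N ->
  len c i = 0 -> slope c i.-1 = slope c i.+1.

Lemma zero_inflection_tail h c : zero_inflection (h :: c) -> zero_inflection c.
Proof. by move=> zc [//|i] _ ic ci0; exact: (zc i.+2). Qed.

Lemma merge_faces_chain r c :
  slope_chain (fun a b => a = b \/ r a b) c ->
  slope_chain r (merge_faces c) /\
  (c <> [::] -> merge_faces c <> [::] /\ slope (merge_faces c) 0 = slope c 0).
Proof.
elim: c => [|h c IH] rc; first by split.
have [rm hd] := IH (slope_chain_tail rc).
rewrite /=; case: c => [|h' c] in rc IH rm hd *; first by split.
have [//|nz] := hd.
case: (merge_faces _) nz rm => // g d _ rm; rewrite /slope /= => hg.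
have [rh _] := (slope_chain_cons2 _ _ _ _).1 rc.
have [hg'|hg'] := eqVneq h.2 g.2.
  by split=> // i ic; move: (rm i ic); case: i ic => [|i] _; rewrite /slope /= -?hg'.
split=> //; apply/slope_chain_cons2; split=> //.
by case: rh => [/eqP|]; rewrite -hg // (negPf hg').
Qed.

(** Between two surviving faces the slopes alternate between two values: [a] is
    the slope of the last survivor and [q] that of the last face visited. *)
Lemma filter_faces_chain_aux r c l k a q :
  slope_chain r ((k, q) :: c) -> zero_inflection ((k, q) :: c) ->
  q = a \/ (r a q /\ forall h d, c = h :: d -> h.2 = a) ->
  slope_chain (fun a b => a = b \/ r a b)
    ((l, a) :: [seq f <- c | f.1 != 0]).
Proof.
elim: c l k a q => [|[l1 p1] c IH] l k a q rc zc; first by move=> _ [].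
have [/= rqp rc'] := (slope_chain_cons2 _ _ _ _).1 rc.
have zc' := zero_inflection_tail zc.
move=> I; have [l10|l10] := eqVneq l1 0; rewrite /= ?l10 ?eqxx ?l10 /=.
  apply: IH rc' zc' _; case: I => [qa|[raq nx]]; last by left; exact: (nx (l1, p1) c).
  right; split; first by rewrite -qa.
  move=> h d E; rewrite -qa; apply/esym.
  by have := zc 1%N; rewrite E; apply.
apply/slope_chain_cons2; split=> /=; last by apply: IH rc' zc' _; left.
by case: I => [qa|[_ /(_ (l1, p1) c erefl) /= ->]]; [right; rewrite -qa|left].
Qed.

Lemma filter_faces_chain r c : slope_chain r c -> zero_inflection c ->
  slope_chain (fun a b => a = b \/ r a b) [seq f <- c | f.1 != 0].
Proof.
elim: c => [|[l p] c IH] rc zc //=.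
case: ifP => _; last exact: IH (slope_chain_tail rc) (zero_inflection_tail zc).
by apply: filter_faces_chain_aux rc zc _; left.
Qed.

Lemma remove_faces_chain r c : slope_chain r c -> zero_inflection c ->
  slope_chain r (remove_faces c).
Proof.
by move=> rc zc; case: (merge_faces_chain (filter_faces_chain rc zc)).
Qed.

(** Sums over the faces of a function [F p x y] of the slope [p] and of the end
    points [x] and [y] that is additive in the segment. *)
Variable F : R -> R -> R -> R.
Hypothesis F_add : forall p x y z, F p x y + F p y z = F p x z.

(** The sum over the faces of [c], the first of which starts at [a]. *)
Fixpoint face_sum_from (a : R) c : R :=
  match c with
  | [::] => 0
  | h :: c' => F h.2 a (a + h.1) + face_sum_from (a + h.1) c'
  end.

(** The same sum for faces that start at 0, indexed by the rank of the face. *)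
Definition face_sum c :=
  \sum_(0 <= i < size c) F (slope c i) (corner c i) (corner c i.+1).

Lemma face_sum_fromE a c : face_sum_from a c =
  \sum_(0 <= i < size c) F (slope c i) (a + corner c i) (a + corner c i.+1).
Proof.
elim: c a => [|h c IH] a /=; first by rewrite big_geq.
rewrite big_nat_recl //= IH corner_cons !corner0 !addr0; congr (_ + _).
by apply: eq_bigr => i _; rewrite !corner_cons !addrA.
Qed.

Lemma face_sum_from0 c : face_sum c = face_sum_from 0 c.
Proof. by rewrite face_sum_fromE; apply: eq_bigr => i _; rewrite !add0r. Qed.

Lemma face_sum_filter a c :
  face_sum_from a [seq f <- c | f.1 != 0] = face_sum_from a c.
Proof.
elim: c a => [//|[l p] c IH] a /=.
have [->|_] /= := eqVneq l 0; rewrite ?addr0 IH //.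
have F0 : F p a a = 0 by have := F_add p a a a; lra.
by rewrite F0 add0r.
Qed.

Lemma face_sum_merge a c : face_sum_from a (merge_faces c) = face_sum_from a c.
Proof.
elim: c a => [//|h c IH] a /=.
case: (merge_faces c) IH => [|g d] IH /=.
  by rewrite -IH.
have [hg|_] := eqVneq h.2 g.2; rewrite -IH //=.
by rewrite -hg [RHS]addrA F_add !addrA.
Qed.

Lemma face_sum_remove c : face_sum (remove_faces c) = face_sum c.
Proof. by rewrite !face_sum_from0 face_sum_merge face_sum_filter. Qed.

End RemovingFaces.

Lemma max_jump_ub (R : realType) (c : faces R) :
  slope_chain (fun a b => `|b - a| <= max_jump c) c.
Proof.
move=> i ic; rewrite /max_jump.
have : i \in index_iota 0 (size c).-1.
  by rewrite mem_index_iota /= -ltnS prednK // (leq_trans _ ic).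
by move=> ii; exact: (@Order.TotalTheory.le_bigmax_seq _ R _ _ 0 i xpredT
  (fun j => `|slope c j.+1 - slope c j|) ii isT).
Qed.

Lemma max_jump_ge0 (R : realType) (c : faces R) : 0 <= max_jump c.
Proof. exact: bigmax_ge_id. Qed.

(** * Motion with a fixed list of slopes *)

Section Motion.
Context {R : realType}.
Variables (S : set R) (w : R -> R -> R) (t0 t1 : R) (c : R -> faces R).
Hypothesis mv : moves S w t0 t1 c.
Implicit Types (t s : R) (i j : nat).

Let c_slopes t : t \in `[t0, t1] ->
  [seq f.2 | f <- c t] = [seq f.2 | f <- c t0].
Proof. by case: mv => H _ _ _ _; exact: H. Qed.

Lemma moves_size t : t \in `[t0, t1] -> size (c t) = size (c t0).
Proof. by move=> /c_slopes /(congr1 size); rewrite !size_map. Qed.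

Lemma moves_slope t i : t \in `[t0, t1] -> slope (c t) i = slope (c t0) i.
Proof.
move=> tt; have E := c_slopes tt.
have [ic|ci] := ltnP i (size (c t)); last first.
  by rewrite /slope !nth_default -?(moves_size tt).
by rewrite /slope -!(nth_map _ 0 (fun f => f.2)) ?E -?(moves_size tt).
Qed.

Lemma moves_len_continuous i :
  {within `[t0, t1], continuous (fun t => len (c t) i)}.
Proof. by case: mv. Qed.

Lemma moves_corner_continuous i :
  {within `[t0, t1], continuous (fun t => corner (c t) i)}.
Proof.
apply/within_segmentP => t tt; elim: i => [|i IH].
  have -> : (fun s => corner (c s) 0) = (fun=> 0).
    by apply/funext => s; rewrite corner0.
  by rewrite corner0; exact: cvg_cst.
have -> : (fun s => corner (c s) i.+1) = (fun s => corner (c s) i + len (c s) i).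
  by apply/funext => s; rewrite cornerS.
rewrite cornerS.
by apply: cvgD IH _; apply: (within_segmentP _ _ _).1 tt; exact: moves_len_continuous.
Qed.

Lemma moves_has_faces t : t \in `[t0, t1[ -> has_faces S (w^~ t) (c t).
Proof. by case: mv => _ _ H _ _; exact: H. Qed.

Lemma corner_speed0 (d : faces R) : corner_speed d 0 = 0.
Proof. by rewrite /corner_speed !subrr mul0r oppr0. Qed.

Lemma corner_speed_size (d : faces R) : corner_speed d (size d) = 0.
Proof.
have v1 : velocity d (size d) = 0.
  by rewrite /velocity; case: ifP => // /andP[_]; rewrite ltnNge leqnSn.
have v2 : velocity d (size d).-1 = 0.
  by rewrite /velocity; case: (size d) => // n; rewrite ltnn andbF.
by rewrite /corner_speed v1 v2 subrr mul0r oppr0.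
Qed.

Lemma moves_corner_der D t i : t \in `]t0, t1[ -> (i <= size (c t0))%N ->
  has_der D (fun s => corner (c s) i) t (corner_speed (c t) i).
Proof.
move=> tt; have tcc := subset_itv_oo_cc tt.
rewrite -(moves_size tcc) leq_eqVlt => /predU1P[->|ic]; last first.
  have [->|i0] := posnP i.
    rewrite corner_speed0; apply: has_der_ext (has_der_cst D 0 t) => s.
    by rewrite corner0.
  apply: is_derive_has_der; case: mv => _ _ _ _; apply => //.
  by rewrite i0.
rewrite corner_speed_size.
have one s : s \in `]t0, t1[ -> 1 = corner (c s) (size (c t)).
  move=> ss; rewrite (moves_size tcc) -(moves_size (subset_itv_oo_cc ss)).
  by have [] := moves_has_faces (subset_itv_oo_co ss).
apply: has_der_eq (has_der_cst D 1 t); last exact: one.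
by have := near_in_itvoo tt; apply: filterS => s ss _; exact: one.
Qed.

Lemma moves_len_der D t i : t \in `]t0, t1[ -> (i < size (c t0))%N ->
  has_der D (fun s => len (c s) i) t
    (corner_speed (c t) i.+1 - corner_speed (c t) i).
Proof.
move=> tt ic.
have := has_derB (moves_corner_der D tt ic) (moves_corner_der D tt (ltnW ic)).
by apply: has_der_ext => s; rewrite cornerS addrC addKr.
Qed.

End Motion.

Arguments moves_len_continuous {R S w t0 t1 c} mv i.
Arguments moves_corner_continuous {R S w t0 t1 c} mv i.

(** * Maximum principle for the speeds of the faces *)

Section MaximumPrinciple.
Context {R : realType}.

Lemma within_closed_ge (a b k : R) (f : R -> R) : a < b ->
  {within `[a, b], continuous f} -> (forall t, t \in `[a, b[ -> k <= f t) ->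
  k <= f b.
Proof.
move=> ab fc fk; rewrite leNgt; apply/negP => fbk.
have bb : b \in `[a, b] by rewrite in_itv /= lexx ltW.
have PF := within_segment_proper ab bb.
have /cvgrPdist_lt /(_ (k - f b)) := (within_segmentP _ _ _).1 fc b bb.
rewrite subr_gt0 near_withinE => /(_ fbk) H.
have : \forall y \near within `[a, b] b^', y != b /\ y \in `[a, b] /\ `|f b - f y| < k - f b.
  by apply/near_within_dnbhs; apply: filterS H => y h yb yab; do 2 split=> //; exact: h.
move=> /filter_ex[y [yb [yab]]]; move: yab; rewrite in_itv /= => /andP[ay yb'].
have := fk y; rewrite in_itv /= ay lt_neqAle yb yb' => /(_ isT) ky.
by rewrite distrC ger0_norm; lra.
Qed.

Lemma has_der_gt0_left (a x l : R) (f : R -> R) : a < x -> 0 < l ->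
  has_der setT f x l -> exists2 y, y \in `]a, x[ & f y < f x.
Proof.
move=> ax l0 fl; have := fl (l / 2); rewrite divr_gt0 // => /(_ isT).
rewrite near_withinE => /nbhs_ballP[d /= d0 dP].
pose y := Num.max ((a + x) / 2) (x - d / 2).
have y1 : (a + x) / 2 <= y by rewrite le_max lexx.
have y2 : x - d / 2 <= y by rewrite le_max lexx orbT.
have yx : y < x by rewrite gt_max; apply/andP; split; lra.
exists y; first by rewrite in_itv /= yx andbT; lra.
have := dP y; rewrite /ball /= gtr0_norm ?subr_gt0 // => /(_ _ I).
have -> : x - y < d by lra.
move=> /(_ isT); rewrite (ltr0_norm (_ : y - x < 0)) ?subr_lt0 // => h.
have := le_trans (ler_norm _) h => {}h.
have : 0 < l * (x - y) by rewrite mulr_gt0 ?subr_gt0.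
by move: h; rewrite -!mulrA; nra.
Qed.

Lemma argmin_nat (P : pred nat) n (F : nat -> R) : (exists2 i, (i < n)%N & P i) ->
  exists i, [/\ (i < n)%N, P i & forall j, (j < n)%N -> P j -> F i <= F j].
Proof.
case=> i0 i0n Pi0.
pose Q := [pred i : 'I_n | P i].
have Q0 : Q (Ordinal i0n) by [].
have [i Pi iM] := arg_minP (fun i : 'I_n => F i) Q0.
by exists i; split=> // j jn Pj; exact: (iM (Ordinal jn)).
Qed.

(** Slopes that step between adjacent elements of [S] either come back or go on
    in the same direction. *)
Lemma adjacent_turn (S : set R) (a b d : R) : Defs.adjacent S a b -> Defs.adjacent S b d ->
  a != d -> (a < b /\ b < d) \/ (d < b /\ b < a).
Proof.
move=> [Sa Sb ab nab] [_ Sd bd nbd] ad.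
have [h1|h1|/eqP] := ltgtP a b; last by rewrite (negPf ab).
- have [h2|h2|/eqP] := ltgtP b d; [by left| |by rewrite (negPf bd)].
  have [h3|h3|/eqP] := ltgtP a d; last by rewrite (negPf ad).
  + by case: nab; exists d; split=> //; left; rewrite h3.
  + by case: nbd; exists a; split=> //; right; rewrite h3.
- have [h2|h2|/eqP] := ltgtP b d; [|by right|by rewrite (negPf bd)].
  have [h3|h3|/eqP] := ltgtP a d; last by rewrite (negPf ad).
  + by case: nbd; exists a; split=> //; left; rewrite h1.
  + by case: nab; exists d; split=> //; right; rewrite h2.
Qed.

(** A convex or concave face whose speed is the largest in absolute value does
    not shrink. *)
Lemma fastest_face_grows (S : set R) (d : faces R) i : (0 < i)%N ->
  (i.+1 < size d)%N -> slope_chain (Defs.adjacent S) d -> 0 < len d i ->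
  slope d i.-1 != slope d i.+1 ->
  (forall j, `|velocity d j| <= `|velocity d i|) ->
  0 <= corner_speed d i.+1 - corner_speed d i.
Proof.
move=> i0 ic adj li ne vmax; rewrite /corner_speed /=.
have a1 := adj i ic; have := adj i.-1; rewrite prednK // => /(_ (ltnW ic)) a0.
have vi : velocity d i = (slope d i.+1 - slope d i.-1) / (2 * len d i).
  by rewrite /velocity i0 ic.
have := vmax i.+1; have := vmax i.-1; rewrite !ler_norml opprK => /andP[].
set v := velocity d i in vi *; set v1 := velocity d _; set v2 := velocity d _.
rewrite -mulNr opprB.
case: (adjacent_turn a0 a1 ne) => -[h1 h2].
- have v0 : 0 < v by rewrite vi divr_gt0 ?mulr_gt0 // subr_gt0 (lt_trans h1).
  rewrite (gtr0_norm v0) => _ h3 /andP[_ h4].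
  by rewrite addr_ge0 // divr_ge0 //; lra.
- have v0 : v < 0.
    by rewrite vi -opprB mulNr oppr_lt0 divr_gt0 ?mulr_gt0 // subr_gt0 (lt_trans h1).
  rewrite (ltr0_norm v0) opprK => h3 _ /andP[h4 _].
  have e (x y : R) : x / y = (- x) / (- y) by rewrite invrN mulrNN.
  rewrite addr_ge0 //; first by rewrite e divr_ge0 //; lra.
  by rewrite e divr_ge0 //; lra.
Qed.

End MaximumPrinciple.

Section CurvedFaces.
Context {R : realType}.
Variables (S : set R) (w : R -> R -> R) (t0 t1 : R) (c : R -> faces R).
Hypothesis mv : moves S w t0 t1 c.
Hypothesis t01 : t0 < t1.
Hypothesis adj : slope_chain (Defs.adjacent S) (c t0).
Implicit Types (t s : R) (i j : nat).

Let N := size (c t0).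
(** The inner faces whose speed is not zero. *)
Let curved : pred nat := fun i =>
  [&& (0 < i)%N, (i.+1 < N)%N & slope (c t0) i.-1 != slope (c t0) i.+1].
Let kappa i := `|slope (c t0) i.+1 - slope (c t0) i.-1| / 2.
(** The inverse of the absolute speed of a curved face. *)
Let slowness i t := len (c t) i / kappa i.

Let kappa_gt0 i : curved i -> 0 < kappa i.
Proof. by move=> /and3P[_ _ ne]; rewrite divr_gt0 ?normr_gt0 // subr_eq0 eq_sym. Qed.

Let t00 : t0 \in `[t0, t1[. Proof. by rewrite in_itv /= lexx. Qed.

Lemma moves_len_gt0 t i : t \in `[t0, t1[ -> (i < N)%N -> 0 < len (c t) i.
Proof.
move=> tt; rewrite /N -(moves_size mv (subset_itv_co_cc tt)) => ic.
by have [H _ _] := moves_has_faces mv tt; have [] := H i ic.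
Qed.

Let speed_curved t i : t \in `[t0, t1[ -> curved i ->
  `|velocity (c t) i| = (slowness i t)^-1.
Proof.
move=> tt ci; have /and3P[i0 iN _] := ci.
have tcc := subset_itv_co_cc tt; have l0 := moves_len_gt0 tt (ltnW iN).
rewrite /velocity i0 (moves_size mv tcc) iN /= !(moves_slope mv _ tcc).
rewrite /slowness /kappa normrM normfV (gtr0_norm (mulr_gt0 _ l0)) //.
by rewrite invf_div -mulrA -invfM.
Qed.

Let speed_flat t i : t \in `[t0, t1[ -> ~~ curved i -> velocity (c t) i = 0.
Proof.
move=> tt; have tcc := subset_itv_co_cc tt.
rewrite /velocity (moves_size mv tcc) !(moves_slope mv _ tcc) /curved -/N andbA.
by case: ifP => //= _; rewrite negbK => /eqP ->; rewrite subrr mul0r.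
Qed.

Let slowness_continuous i : {within `[t0, t1], continuous (slowness i)}.
Proof.
apply/within_segmentP => t tt.
have lc := (within_segmentP _ _ _).1 (moves_len_continuous mv i) t tt.
exact: cvgM lc (cvg_cst _).
Qed.

(** The minimum over the curved faces of the slowness, plus a small multiple of the
    time, is attained at the initial time; the extra term makes the derivative at
    a later minimum strictly positive. *)
Let slowness_tilted e s g : 0 < e -> s \in `]t0, t1[ ->
  (forall i, curved i -> g <= slowness i t0) ->
  forall i, curved i -> g <= slowness i s + e * (s - t0).
Proof.
move=> e0; rewrite in_itv /= => /andP[t0s st1] g0 i0 ci0.
pose h i t := slowness i t + e * (t - t0).
have hc i : {within `[t0, s], continuous (h i)}.
  apply: (@within_segmentS _ t0 t1); rewrite ?lexx ?(ltW st1) //.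
  apply/within_segmentP => t tt.
  have sc := (within_segmentP _ _ _).1 (@slowness_continuous i) t tt.
  apply: cvgD sc _; apply: has_der_continuous.
  exact: has_derZ e (has_derB (has_der_id _ t) (has_der_cst _ t0 t)).
pose m i := s2val (cid2 (EVT_min (ltW t0s) (@hc i))).
have m01 i : m i \in `[t0, s] := s2valP (cid2 (EVT_min (ltW t0s) (@hc i))).
have mP i t : t \in `[t0, s] -> h i (m i) <= h i t :=
  s2valP' (cid2 (EVT_min (ltW t0s) (@hc i))) t.
have curvedN i : curved i -> (i < N)%N by move=> /and3P[_ /ltnW].
have [i [iN ci imin]] := argmin_nat (fun i => h i (m i))
  (ex_intro2 _ _ i0 (curvedN _ ci0) ci0).
have {imin mP}tmin j t : curved j -> t \in `[t0, s] -> h i (m i) <= h j t.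
  by move=> cj tt; apply: le_trans (mP j t tt); exact: imin (curvedN _ cj) cj.
have : h i (m i) <= h i0 s by apply: tmin => //; rewrite in_itv /= lexx ltW.
apply: le_trans; have := m01 i; set t := m i in tmin *.
rewrite in_itv /= le_eqVlt => /andP[/predU1P[<-|t0t] ts].
  by rewrite /h subrr mulr0 addr0 g0.
exfalso.
have tt : t \in `]t0, t1[ by rewrite in_itv /= t0t (le_lt_trans ts).
have tco := subset_itv_oo_co tt; have tcc := subset_itv_oo_cc tt.
have slow_gt0 j : curved j -> 0 < slowness j t.
  by move=> cj; rewrite divr_gt0 ?kappa_gt0 ?moves_len_gt0 ?curvedN.
have grows : 0 <= corner_speed (c t) i.+1 - corner_speed (c t) i.
  have /and3P[ip ip1 ne] := ci.
  apply: (@fastest_face_grows _ S) => //.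
  - by rewrite (moves_size mv tcc).
  - by move=> j; rewrite (moves_size mv tcc) !(moves_slope mv _ tcc); exact: adj.
  - exact: moves_len_gt0.
  - by rewrite !(moves_slope mv _ tcc).
  - move=> j; rewrite (speed_curved tco ci).
    have [cj|cj] := boolP (curved j); last first.
      by rewrite (speed_flat tco cj) normr0 invr_ge0 ltW // slow_gt0.
    rewrite (speed_curved tco cj) lef_pV2 ?posrE ?slow_gt0 //.
    by have := tmin j t cj; rewrite in_itv /= ltW // ts lerD2r; apply.
have dh : has_der setT (h i) t
    ((kappa i)^-1 * (corner_speed (c t) i.+1 - corner_speed (c t) i) + e * (1 - 0)).
  apply: has_derD; last exact: has_derZ (has_derB (has_der_id _ _) (has_der_cst _ _ _)).
  apply: has_der_ext (has_derZ _ (moves_len_der mv setT tt iN)) => y.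
  by rewrite mulrC.
have [|y] := has_der_gt0_left t0t _ dh.
  by rewrite subr0 mulr1 ltr_wpDl // mulr_ge0 // invr_ge0 ltW // kappa_gt0.
rewrite in_itv /= => /andP[t0y yt]; apply/negP; rewrite -leNgt.
by apply: tmin => //; rewrite in_itv /= !ltW // (lt_le_trans yt).
Qed.

Let slowness_ge g : (forall i, curved i -> g <= slowness i t0) ->
  forall t i, t \in `[t0, t1] -> curved i -> g <= slowness i t.
Proof.
move=> g0; have H s i : s \in `[t0, t1[ -> curved i -> g <= slowness i s.
  rewrite in_itv /= le_eqVlt => /andP[/predU1P[<- _|t0s st1]] ci; first exact: g0.
  have st : s \in `]t0, t1[ by rewrite in_itv /= t0s.
  rewrite leNgt; apply/negP => sg.
  (* With this e the tilt at time s is half of the assumed deficit. *)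
  pose e := (g - slowness i s) / (2 * (s - t0)).
  have e0 : 0 < e by rewrite divr_gt0 ?mulr_gt0 ?subr_gt0.
  have := slowness_tilted e0 st g0 ci.
  have -> : e * (s - t0) = (g - slowness i s) / 2.
    by rewrite /e; field; lra.
  by move: sg; lra.
move=> t i; rewrite in_itv /= (le_eqVlt t) => /andP[t0t /predU1P[->|tt1]] ci.
  apply: within_closed_ge t01 (@slowness_continuous i) _ => s ss; exact: H.
by apply: H; rewrite // in_itv /= t0t.
Qed.

Let curved_len_gt0 i : curved i -> 0 < len (c t1) i.
Proof.
move=> ci.
have curvedN j : curved j -> (j < N)%N by move=> /and3P[_ /ltnW].
have [j [jN cj jmin]] := argmin_nat (fun i => slowness i t0)
  (ex_intro2 _ _ i (curvedN _ ci) ci).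
have sj : 0 < slowness j t0 by rewrite divr_gt0 ?kappa_gt0 ?moves_len_gt0.
have : 0 < slowness i t1.
  apply: lt_le_trans sj _; apply: slowness_ge => // [k ck|].
    exact: jmin (curvedN _ ck) ck.
  by rewrite in_itv /= lexx ltW.
by rewrite pmulr_lgt0 // invr_gt0 kappa_gt0.
Qed.

(** No face vanishes between two neighbours of different slopes. *)
Lemma moves_zero_inflection : zero_inflection (c t1).
Proof.
have t1cc : t1 \in `[t0, t1] by rewrite in_itv /= lexx ltW.
move=> i i0; rewrite (moves_size mv t1cc) !(moves_slope mv _ t1cc) => iN l0.
apply/eqP; apply/negPn/negP => ne.
have : 0 < len (c t1) i by apply: curved_len_gt0; rewrite /curved i0 iN.
by rewrite l0 ltxx.
Qed.

End CurvedFaces.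

(** * Functions on the rectangle *)

Section Rectangle.
Context {R : realType}.
Variable T : R.
Implicit Types (f : R -> R -> R) (x y t s e d : R).

(** Continuity on the rectangle [0, 1] x [0, T], in epsilon-delta form. *)
Definition cont_rect f := forall x t, x \in `[0, 1] -> t \in `[0, T] ->
  forall e, 0 < e -> exists2 d, 0 < d & forall y s, y \in `[0, 1] ->
    s \in `[0, T] -> `|y - x| < d -> `|s - t| < d -> `|f y s - f x t| < e.

Lemma within_cont_rect f :
  {within `[0, 1]%classic `*` `[0, T]%classic,
    continuous (fun z : R * R => f z.1 z.2)} -> cont_rect f.
Proof.
move=> /subspace_continuousP fc x t xx tt e e0.
have /cvgrPdist_lt /(_ e e0) := fc (x, t) (conj xx tt).
rewrite near_withinE => /nbhs_ballP[d /= d0 dP]; exists d => // y s yy ss yx st.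
rewrite distrC; apply: (dP (y, s)) => //.
by split; rewrite /ball /= distrC.
Qed.

Lemma cont_rect_slice f t : cont_rect f -> t \in `[0, T] ->
  {within `[0, 1], continuous (f^~ t)}.
Proof.
move=> fc tt; apply/within_segmentP => x xx; apply/cvgrPdist_lt => e e0.
have [d d0 dP] := fc x t xx tt e e0.
rewrite near_withinE; apply/nbhs_ballP; exists d => //= y yx yy.
by rewrite distrC dP // ?subrr ?normr0 // distrC.
Qed.

(** Continuity in time is uniform in space. *)
Lemma cont_rect_unif f t e : cont_rect f -> t \in `[0, T] -> 0 < e ->
  exists2 d, 0 < d & forall x s, x \in `[0, 1] -> s \in `[0, T] ->
    `|s - t| < d -> `|f x s - f x t| < e.
Proof.
move=> fc tt e0.
have /compact_near_coveringP cov := @segment_compact R 0 1.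
pose P s x := x \in `[0, 1] -> s \in `[0, T] -> `|f x s - f x t| < e.
have := cov R (nbhs t) P (nbhs_filter t).
have H x : `[0, 1]%classic x -> \forall x' \near x & s \near nbhs t, P s x'.
  move=> /= xx; have e20 : 0 < e / 2 by rewrite divr_gt0.
  have [d d0 dP] := fc x t xx tt _ e20.
  exists (ball x d, ball t d); first by split; exact: nbhsx_ballx.
  move=> [y s] /= []; rewrite /ball /= => yx st yy ss.
  have h1 := dP y s yy ss; have h2 := dP y t yy tt.
  rewrite subrr normr0 in h2.
  rewrite distrC in yx; rewrite distrC in st.
  have {}h1 := h1 yx st; have {}h2 := h2 yx d0.
  have -> : f y s - f y t = (f y s - f x t) - (f y t - f x t) by ring.
  by rewrite (le_lt_trans (ler_normB _ _)) // [e]splitr ltrD.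
move=> /(_ H) /nbhs_ballP[d /= d0 dP]; exists d => // x s xx ss st.
by apply: (dP s) => //; rewrite /ball /= distrC.
Qed.

(** Mean value theorem for derivatives relative to a segment. *)
Lemma segment_MVT a b (g g' : R -> R) x y :
  (forall z, z \in `[a, b] -> has_der `[a, b] g z (g' z)) ->
  x \in `[a, b] -> y \in `[a, b] ->
  exists z, [/\ z \in `[a, b], `|z - x| <= `|y - x| & g y - g x = g' z * (y - x)].
Proof.
move=> dg; rewrite !in_itv /= => /andP[ax xb] /andP[ay yb].
have gc := has_der_segment_continuous dg.
have H x1 y1 : a <= x1 -> y1 <= b -> x1 < y1 ->
    exists2 z, z \in `]x1, y1[ & g y1 - g x1 = g' z * (y1 - x1).
  move=> ax1 yb1 xy; apply: has_der_MVT => //; first exact: within_segmentS gc.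
  move=> z; rewrite in_itv /= => /andP[xz zy]; apply: has_der_sub (dg z _).
    move=> v /=; rewrite !in_itv /= => /andP[h1 h2].
    by rewrite (le_trans ax1 (ltW h1)) (le_trans (ltW h2)).
  by rewrite in_itv /= (le_trans ax1 (ltW xz)) (le_trans (ltW zy)).
have [xy|yx|xy] := ltgtP x y.
- have [z] := H x y ax yb xy; rewrite in_itv /= => /andP[xz zy] gz.
  exists z; split=> //; first by rewrite in_itv /= (le_trans ax (ltW xz)) (le_trans (ltW zy)).
  by rewrite !gtr0_norm ?subr_gt0 // lerD2r ltW.
- have [z] := H y x ay xb yx; rewrite in_itv /= => /andP[yz zx] gz.
  exists z; split=> //; first by rewrite in_itv /= (le_trans ay (ltW yz)) (le_trans (ltW zx)).
    by rewrite !ltr0_norm ?subr_lt0 // lerN2 lerD2r ltW.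
  by rewrite -opprB gz; ring.
- by rewrite -xy; exists x; split; rewrite ?in_itv /= ?ax ?xb ?subrr ?mulr0.
Qed.

Lemma segment_bounded a b (g : R -> R) : a <= b -> {within `[a, b], continuous g} ->
  exists2 B, 0 < B & forall x, x \in `[a, b] -> `|g x| <= B.
Proof.
move=> ab gc; have [x1 _ h1] := EVT_max ab gc; have [x2 _ h2] := EVT_min ab gc.
exists (1 + `|g x1| + `|g x2|) => [|x xx]; first by rewrite -addrA ltr_wpDr ?addr_ge0.
rewrite ler_norml; have := h1 x xx; have := h2 x xx.
have := ler_norm (g x1); have := ler_norm (- g x2); rewrite normrN.
by have := normr_ge0 (g x1); have := normr_ge0 (g x2); lra.
Qed.

(** Chain rule along a moving abscissa. *)
Lemma has_der_curve (D : set R) (f fx : R -> R -> R) (X : R -> R) t l k :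
  cont_rect fx ->
  (forall x s, x \in `[0, 1] -> s \in `[0, T] -> has_der `[0, 1] (f^~ s) x (fx x s)) ->
  D `<=` `[0, T] -> D t -> (forall s, D s -> X s \in `[0, 1]) ->
  has_der D X t l -> has_der D (f (X t)) t k ->
  has_der D (fun s => f (X s) s) t (fx (X t) t * l + k).
Proof.
move=> fxc dfx DT Dt X01 dX dft.
suff H : has_der D (fun s => f (X s) s - f (X t) s) t (fx (X t) t * l).
  by have := has_derD H dft; apply: has_der_ext => s; rewrite subrK.
move=> e e0; pose M := 1 + `|l|; have M0 : 0 < M by rewrite ltr_wpDr.
have e20 : 0 < e / 2 by rewrite divr_gt0.
have [d d0 dP] := fxc _ t (X01 t Dt) (DT _ Dt) _ (divr_gt0 e20 M0).
have near1 : \forall s \near within D (nbhs t), `|X t - X s| < d.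
  by have /cvgrPdist_lt := has_der_continuous dX; apply.
have near2 : \forall s \near within D (nbhs t), `|s - t| < d.
  rewrite near_withinE; apply/nbhs_ballP; exists d => //= s.
  by rewrite /ball /= distrC.
have near3 := dX 1 ltr01; have near4 := has_derZ (fx (X t) t) dX e20.
have near5 : \forall s \near within D (nbhs t), D s.
  by rewrite near_withinE; apply: filterE.
near=> s; have Ds : D s by near: s.
have Xs : `|X s - X t| <= M * `|s - t|.
  have : `|X s - X t - l * (s - t)| <= 1 * `|s - t| by near: s.
  rewrite mul1r mulrDl mul1r -normrM => h.
  rewrite -[X s - X t](subrK (l * (s - t))) (le_trans (ler_normD _ _)) //.
  by rewrite lerD2r.
have [z [z01 zx fE]] := segment_MVT (fun z zz => dfx z s zz (DT _ Ds)) (X01 t Dt) (X01 s Ds).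
have zd : `|fx z s - fx (X t) t| <= e / 2 / M.
  apply/ltW/dP => //; [exact: DT|apply: le_lt_trans zx _; rewrite distrC|].
    by near: s.
  by near: s.
rewrite subrr subr0 fE.
have -> : fx z s * (X s - X t) - fx (X t) t * l * (s - t) =
    (fx z s - fx (X t) t) * (X s - X t) +
    (fx (X t) t * X s - fx (X t) t * X t - fx (X t) t * l * (s - t)) by ring.
rewrite (le_trans (ler_normD _ _)) //.
have -> : e * `|s - t| = e / 2 * `|s - t| + e / 2 * `|s - t|.
  by rewrite -mulrDl -splitr.
apply: lerD.
  rewrite normrM (le_trans (ler_pM _ _ zd Xs)) //.
  by rewrite mulrA divfK // gt_eqF.
by near: s.
Unshelve. all: by end_near. Qed.

(** The integral of a continuous function is a primitive of it. *)
Lemma integral_has_der a b (g : R -> R) t : a < b ->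
  {within `[a, b], continuous g} -> t \in `[a, b] ->
  has_der `[a, b] (fun s => \int[@lebesgue_measure R]_(x in `[a, s]) g x) t (g t).
Proof.
move=> ab gc tt; set H := fun s => _.
have Hi s : s \in `[a, b] -> has_int g a s (H s).
  rewrite in_itv /= => /andP[as_ sb]; apply: continuous_has_int => //.
  exact: within_segmentS gc.
have inc s r e : s \in `[a, b] -> r \in `[a, b] -> s <= r ->
    (forall z, z \in `]s, r[ -> `|g z - g t| <= e) ->
    `|H r - H s - g t * (r - s)| <= e * (r - s).
  move=> ss rr sr he.
  have as_ : a <= s by move: ss; rewrite in_itv /= => /andP[].
  have [v1 [v2 [h1 h2 vE]]] := has_int_split as_ sr (Hi r rr).
  have h3 := has_intB h2 (has_int_cst (g t) sr).
  have -> : H r - H s - g t * (r - s) = v2 - g t * (r - s).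
    by rewrite vE (has_int_uniq h1 (Hi s ss)); ring.
  rewrite ler_norml; apply/andP; split.
    rewrite -mulNr; apply: has_int_le (has_int_cst (- e) sr) h3 _ => z zz.
    by have := he z zz; rewrite ler_norml => /andP[].
  apply: has_int_le h3 (has_int_cst e sr) _ => z zz.
  by have := he z zz; rewrite ler_norml => /andP[].
move=> e e0.
have /cvgrPdist_le /(_ e e0) := (within_segmentP _ _ _).1 gc t tt.
rewrite !near_withinE => /nbhs_ballP[d /= d0 dP].
apply/nbhs_ballP; exists d => //= s; rewrite /ball /= => sd ss.
move: (tt) (ss); rewrite !in_itv /= => /andP[at_ tb] /andP[as_ sb].
have [ts|st] := leP t s.
- rewrite (ger0_norm (_ : 0 <= s - t)) ?subr_ge0 //; apply: inc => // z.
  rewrite in_itv /= => /andP[tz zs]; rewrite distrC; apply: dP.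
    rewrite /ball /= distrC gtr0_norm ?subr_gt0 //.
    by move: sd; rewrite distrC ger0_norm ?subr_ge0 //; lra.
  by rewrite /= in_itv /=; lra.
- rewrite (ltr0_norm (_ : s - t < 0)) ?subr_lt0 // opprB -normrN.
  have -> : - (H s - H t - g t * (s - t)) = H t - H s - g t * (t - s) by ring.
  apply: inc => //; first exact: ltW.
  move=> z; rewrite in_itv /= => /andP[sz zt]; rewrite distrC; apply: dP.
    rewrite /ball /= gtr0_norm ?subr_gt0 //.
    by move: sd; rewrite gtr0_norm ?subr_gt0 //; lra.
  by rewrite /= in_itv /=; lra.
Qed.

End Rectangle.

(** * Essential supremum norm *)

Section EssentialSupremum.
Context {R : realType}.
Implicit Types (f : R -> R) (x B m : R).
Notation mu := (@lebesgue_measure R).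

Lemma lebesgue_setT_gt0 : (0 < mu [set: R])%E.
Proof.
apply: (@lt_le_trans _ _ (mu `[0, 1])).
  by rewrite lebesgue_measure_itv /= lte_fin ltr01 oppr0 adde0 lte_fin ltr01.
by apply: le_measure => //; rewrite inE.
Qed.

Lemma Linf01_ge0 f : (0 <= Linf01 f)%E.
Proof. exact: Lnorm_ge0. Qed.

Lemma Linf01_leP f B : (Linf01 f <= B%:E)%E <->
  {ae mu, forall x, (`| (f \_ `[0, 1]) x|%:E <= B%:E)%E}.
Proof.
rewrite /Linf01 unlock /Lnorm lebesgue_setT_gt0; split.
  by move=> /ess_supP.
by move=> ?; apply/ess_supP.
Qed.

Lemma Linf01_le f B : 0 <= B -> {in `]0, 1[, forall x, `|f x| <= B} ->
  (Linf01 f <= B%:E)%E.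
Proof.
move=> B0 fB; apply/Linf01_leP; exists [set 0; 1]; split.
- exact: measurableU.
- by apply: countable_lebesgue_measure0; apply: finite_set_countable; exact: finite_set2.
- move=> x /= /negP; rewrite -ltNge lte_fin patchE.
  case: ifPn => [|_]; last by rewrite normr0 ltNge B0.
  rewrite inE /= in_itv /= => /andP[x0 x1] Bf.
  have [->|xn0] := eqVneq x 0; first by left.
  have [->|xn1] := eqVneq x 1; first by right.
  have /fB : x \in `]0, 1[ by rewrite in_itv /= !lt_neqAle eq_sym xn0 xn1 x0.
  by rewrite leNgt Bf.
Qed.

(** An essential bound holds at the points of continuity. *)
Lemma le_Linf01 f x m : (Linf01 f <= m%:E)%E -> x \in `]0, 1[ ->
  f y @[y --> x] --> f x -> `|f x| <= m.
Proof.
move=> /Linf01_leP fm x01 fx; rewrite leNgt; apply/negP => mfx.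
have : \forall y \near x, m < `|f y| /\ y \in `]0, 1[.
  have h1 := near_in_itvoo x01.
  have h2 : \forall y \near x, m < `|f y|.
    have /cvgrPdist_lt /(_ (`|f x| - m)) := fx.
    rewrite subr_gt0 => /(_ mfx); apply: filterS => y h.
    have := ler_dist_dist (f x) (f y); have := ler_norm (`|f x| - `|f y|); lra.
  by apply: filterS2 h1 h2 => y.
move=> /nbhs_ballP[d /= d0 dP].
have [N [mN N0 fN]] := fm.
have : (mu (ball x d) <= mu N)%E.
  apply: le_measure; rewrite ?inE //; first exact: measurable_ball.
  move=> y /dP[my y01]; apply: fN => /=; apply/negP.
  by rewrite -ltNge lte_fin patchE mem_set //=; exact: subset_itv_oo_cc.
by rewrite N0 lebesgue_measure_ball ?(ltW d0) // lee_fin leNgt mulrn_wgt0.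
Qed.

End EssentialSupremum.

(** * The solution of the heat equation *)

Section HeatSolution.
Context {R : realType}.
Variables (T : R) (u0 : R -> R) (u : R -> R -> R).
Hypotheses (T_gt0 : 0 < T) (u_C3 : Ck_rect T 3 u) (u_heat : heat_solution T u0 u).
Implicit Types (x t s : R).
Notation mu := (@lebesgue_measure R).
Notation ux := (dx u).
Notation uxx := (dx (dx u)).
Notation uxxx := (dx (dx (dx u))).
Notation ut := (dt T u).
Notation K := (uxxx_norm u).

Let Ck_cont k f : Ck_rect T k f -> cont_rect T f.
Proof. by case: k => [|k] [/within_cont_rect]. Qed.

Let Ck_dx k f x t : Ck_rect T k.+1 f -> x \in `[0, 1] -> t \in `[0, T] ->
  has_der `[0, 1] (f^~ t) x (dx f x t).
Proof. by move=> [_ [H _ _]] xx tt; apply: derivable_in_has_der; case: (H x t xx tt). Qed.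

Let ux_C2 : Ck_rect T 2 ux. Proof. by have [_ [_ H _]] := u_C3; exact: H. Qed.
Let uxx_C1 : Ck_rect T 1 uxx. Proof. by have [_ [_ H _]] := ux_C2; exact: H. Qed.
Let ut_C2 : Ck_rect T 2 ut. Proof. by have [_ [_ _ H]] := u_C3; exact: H. Qed.

Lemma u_cont : cont_rect T u. Proof. exact: Ck_cont u_C3. Qed.
Lemma ux_cont : cont_rect T ux. Proof. exact: Ck_cont ux_C2. Qed.
Lemma uxx_cont : cont_rect T uxx. Proof. exact: Ck_cont uxx_C1. Qed.
Lemma ut_cont : cont_rect T ut. Proof. exact: Ck_cont ut_C2. Qed.
Lemma uxxx_cont : cont_rect T uxxx.
Proof. by have [_ [_ H _]] := uxx_C1; exact: (@Ck_cont 0 _ H). Qed.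

Lemma u_der x t : x \in `[0, 1] -> t \in `[0, T] -> has_der `[0, 1] (u^~ t) x (ux x t).
Proof. exact: Ck_dx u_C3. Qed.

Lemma ux_der x t : x \in `[0, 1] -> t \in `[0, T] -> has_der `[0, 1] (ux^~ t) x (uxx x t).
Proof. exact: Ck_dx ux_C2. Qed.

Lemma uxx_der x t : x \in `[0, 1] -> t \in `[0, T] -> has_der `[0, 1] (uxx^~ t) x (uxxx x t).
Proof. exact: Ck_dx uxx_C1. Qed.

Lemma u_dert x t : x \in `[0, 1] -> t \in `[0, T] -> has_der `[0, T] (u x) t (ut x t).
Proof.
move=> xx tt; apply: derivable_in_has_der.
by case: u_C3 => _ [H _ _]; case: (H x t xx tt).
Qed.

Lemma ut_uxx x t : x \in `[0, 1] -> t \in `[0, T] -> ut x t = uxx x t.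
Proof. by case: u_heat => H _ _; exact: H. Qed.

Lemma ut_boundary t : t \in `[0, T] -> ut 0 t = 0 /\ ut 1 t = 0.
Proof.
case: u_heat => _ _ ub tt.
have H x : (forall s, s \in `[0, T] -> u x s = 0) -> ut x t = 0.
  move=> ux0; apply: (has_der_derive_in T_gt0 tt _).2.
  apply: has_der_eq (has_der_cst _ 0 t); last by rewrite ux0.
  by apply: filterE => s ss; rewrite ux0.
by split; apply: H => s /ub[].
Qed.

Lemma ux_primitive t : t \in `[0, T] -> has_primitive (ux^~ t) (u^~ t).
Proof.
move=> tt; split.
- exact: cont_rect_slice ux_cont tt.
- exact: cont_rect_slice u_cont tt.
- move=> x xx; apply: has_der_sub (u_der (subset_itv_oo_cc xx) tt).
  exact: subset_itv_oo_cc.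
Qed.

Lemma ut_primitive t : t \in `[0, T] -> has_primitive (ut^~ t) (ux^~ t).
Proof.
move=> tt; split.
- exact: cont_rect_slice ut_cont tt.
- exact: cont_rect_slice ux_cont tt.
- move=> x xx; have xc := subset_itv_oo_cc xx; rewrite ut_uxx //.
  by apply: has_der_sub (ux_der xc tt); exact: subset_itv_oo_cc.
Qed.

Let sqr_int (f : R -> R -> R) t : cont_rect T f -> t \in `[0, T] ->
  has_int (fun x => f x t ^+ 2) 0 1 (\int[mu]_(x in `[0, 1]) (f x t ^+ 2)).
Proof.
move=> fc tt; apply: continuous_has_int => //; apply/within_segmentP => x xx.
have fx := (within_segmentP _ _ _).1 (cont_rect_slice fc tt) x xx.
exact: (cvgM fx fx).
Qed.

Lemma ux2_int t : t \in `[0, T] ->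
  has_int (fun x => ux x t ^+ 2) 0 1 (\int[mu]_(x in `[0, 1]) (ux x t ^+ 2)).
Proof. exact: sqr_int ux_cont. Qed.

Lemma ut2_int t : t \in `[0, T] ->
  has_int (fun x => ut x t ^+ 2) 0 1 (\int[mu]_(x in `[0, 1]) (ut x t ^+ 2)).
Proof. exact: sqr_int ut_cont. Qed.

Let ux2_increment s t : s \in `[0, T] -> t \in `[0, T] ->
  has_int (fun x => - ((u x s - u x t) * (ut x s + ut x t))) 0 1
   (\int[mu]_(x in `[0, 1]) (ux x s ^+ 2) - \int[mu]_(x in `[0, 1]) (ux x t ^+ 2)).
Proof.
move=> ss tt; case: u_heat => _ _ ub.
(* P vanishes at both ends, so that its derivative P' has integral zero. *)
pose P x := (u x s - u x t) * (ux x s + ux x t).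
pose P' x := (ux x s - ux x t) * (ux x s + ux x t) +
  (u x s - u x t) * (ut x s + ut x t).
have cs (f : R -> R -> R) r x : cont_rect T f -> r \in `[0, T] -> x \in `[0, 1] ->
    f y r @[y --> within `[0, 1] (nbhs x)] --> f x r.
  by move=> fc rr; exact: (within_segmentP _ _ _).1 (cont_rect_slice fc rr) x.
have dP x : x \in `[0, 1] -> has_der `[0, 1] P x (P' x).
  move=> xx; rewrite /P' !ut_uxx //; apply: has_derM.
    by apply: has_derB; exact: u_der.
  by apply: has_derD; exact: ux_der.
have P0 : has_int P' 0 1 0.
  have P10 : P 1 - P 0 = 0.
    have [h1 h2] := ub s ss; have [h3 h4] := ub t tt.
    by rewrite /P h1 h2 h3 h4 !(subrr, mul0r).
  rewrite -[X in has_int _ _ _ X]P10.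
  apply: (@has_int_ftc _ P' P); first exact: ler01.
  - apply/within_segmentP => x xx; apply: cvgD; apply: cvgM.
    + by apply: cvgB; apply: cs => //; exact: ux_cont.
    + by apply: cvgD; apply: cs => //; exact: ux_cont.
    + by apply: cvgB; apply: cs => //; exact: u_cont.
    + by apply: cvgD; apply: cs => //; exact: ut_cont.
  - exact: has_der_segment_continuous dP.
  - move=> x xx; apply: has_der_sub (dP x (subset_itv_oo_cc xx)).
    exact: subset_itv_oo_cc.
have := has_intB (has_intB (ux2_int ss) (ux2_int tt)) P0.
by rewrite subr0; apply: has_int_ext_oo => x _; rewrite /P'; ring.
Qed.

(** The equation and the boundary values give d/dt of the Dirichlet integral
    without exchanging mixed partial derivatives. *)
Lemma dirichlet_der t : t \in `[0, T] ->
  has_der `[0, T] (fun s => \int[mu]_(x in `[0, 1]) (ux x s ^+ 2)) t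
    (- 2 * \int[mu]_(x in `[0, 1]) (ut x t ^+ 2)).
Proof.
move=> tt e e0.
have [B B0 utB] := segment_bounded (@ler01 R) (cont_rect_slice ut_cont tt).
(* If ut, bounded by B at time t, varies by at most e1, then its products vary by
   at most 3 * B * e1 + e1 ^+ 2 <= e. *)
pose e1 := Num.min 1 (e / (3 * B + 1)).
have BB : 0 < 3 * B + 1 by lra.
have e10 : 0 < e1 by rewrite lt_min ltr01 divr_gt0.
have e11 : e1 <= 1 by rewrite ge_min lexx.
have e1e : e1 * (3 * B + 1) <= e by rewrite -ler_pdivlMr // ge_min lexx orbT.
have [d d0 dP] := cont_rect_unif ut_cont tt e10.
rewrite near_withinE; apply/nbhs_ballP; exists d => //= s.
rewrite /ball /= distrC => std ss.
have I1 := has_intD (ux2_increment ss tt) (has_intZ (2 * (s - t)) (ut2_int tt)).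
have -> : forall a b c : R, a - b - - 2 * c * (s - t) = a - b + 2 * (s - t) * c.
  by move=> *; ring.
have key x : x \in `]0, 1[ -> `|- ((u x s - u x t) * (ut x s + ut x t)) +
    2 * (s - t) * ut x t ^+ 2| <= e * `|s - t|.
  move=> /subset_itv_oo_cc xx.
  have [c [cc ct ->]] := segment_MVT (fun r rr => u_dert xx rr) tt ss.
  have h1 := ltW (dP x c xx cc (le_lt_trans ct std)).
  have h2 := ltW (dP x s xx ss std); have h3 := utB x xx.
  move: (ut x c) (ut x s) (ut x t) h1 h2 h3 => v1 v2 v h1 h2 h3.
  set a := v1 - v in h1; set b := v2 - v in h2.
  have -> : - (v1 * (s - t) * (v2 + v)) + 2 * (s - t) * v ^+ 2 =
      - ((v * b + 2 * (v * a) + a * b) * (s - t)).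
    by rewrite /a /b; ring.
  rewrite normrN normrM ler_wpM2r // (le_trans _ e1e) //.
  have m1 : `|v * b| <= B * e1 by rewrite normrM ler_pM.
  have m2 : `|v * a| <= B * e1 by rewrite normrM ler_pM.
  have m3 : `|a * b| <= 1 * e1 by rewrite normrM ler_pM // (le_trans h1).
  move: m1 m2 m3; rewrite !ler_norml => /andP[? ?] /andP[? ?] /andP[? ?].
  by apply/andP; split; lra.
rewrite ler_norml; apply/andP; split.
- have := has_int_le (has_int_cst (- (e * `|s - t|)) ler01) I1.
  by rewrite subr0 mulr1; apply => x /key; rewrite ler_norml => /andP[].
- have := has_int_le I1 (has_int_cst (e * `|s - t|) ler01).
  by rewrite subr0 mulr1; apply => x /key; rewrite ler_norml => /andP[].
Qed.

Let Linf_uxxx t : t \in `[0, T] -> Linf01 (uxxx^~ t) = (K t)%:E.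
Proof.
move=> tt; rewrite /uxxx_norm fineK //.
have [B B0 fB] := segment_bounded (@ler01 R) (cont_rect_slice uxxx_cont tt).
rewrite ge0_fin_numE ?Linf01_ge0 //; apply: le_lt_trans (ltry B).
by apply: Linf01_le (ltW B0) _ => x /subset_itv_oo_cc; exact: fB.
Qed.

Lemma uxxx_norm_ge0 t : 0 <= K t.
Proof. by rewrite fine_ge0 // Linf01_ge0. Qed.

Lemma uxxx_le x t : x \in `]0, 1[ -> t \in `[0, T] -> `|uxxx x t| <= K t.
Proof.
move=> xx tt; apply: (@le_Linf01 _ (uxxx^~ t)) => //; first by rewrite Linf_uxxx.
have := (within_segmentP _ _ _).1 (cont_rect_slice uxxx_cont tt) x (subset_itv_oo_cc xx).
move=> /cvgrPdist_lt h; apply/cvgrPdist_lt => e /h; rewrite near_withinE.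
by apply: filterS2 (near_in_itvoo xx) => y yy; apply; exact: subset_itv_oo_cc.
Qed.

Lemma uxxx_norm_continuous : {within `[0, T], continuous K}.
Proof.
apply/within_segmentP => t tt; apply/cvgrPdist_le => e e0.
have [d d0 dP] := cont_rect_unif uxxx_cont tt e0.
rewrite near_withinE; apply/nbhs_ballP; exists d => //= s.
rewrite /ball /= distrC => std ss.
have H a b : a \in `[0, T] -> b \in `[0, T] ->
    (forall x, x \in `[0, 1] -> `|uxxx x a - uxxx x b| < e) -> K a <= K b + e.
  move=> aa bb abe; rewrite -lee_fin -Linf_uxxx //.
  apply: Linf01_le => [|x xx]; first by rewrite addr_ge0 ?uxxx_norm_ge0 ?ltW.
  rewrite -[uxxx x a](subrK (uxxx x b)) addrC (le_trans (ler_normD _ _)) //.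
  by rewrite lerD ?uxxx_le // ltW // abe // subset_itv_oo_cc.
have h1 := H s t ss tt (fun x xx => dP x s xx ss std).
have h2 : K t <= K s + e.
  by apply: H => // x xx; rewrite distrC; exact: dP.
move: (K s) (K t) h1 h2 => a b h1 h2.
by rewrite ler_norml; apply/andP; split; lra.
Qed.

(** In space, the time derivative is Lipschitz with constant [K t]. *)
Lemma ut_lipschitz x y t : x \in `[0, 1] -> y \in `[0, 1] -> t \in `[0, T] ->
  `|ut y t - ut x t| <= K t * `|y - x|.
Proof.
move=> + + tt; wlog xy : x y / x < y.
  move=> H xx yy; have [xy|yx|->] := ltgtP x y; first exact: H.
    by rewrite distrC (distrC y); exact: H.
  by rewrite !subrr normr0 mulr0.
move=> xx yy; rewrite !ut_uxx //.
move: (xx) (yy); rewrite !in_itv /= => /andP[x0 x1] /andP[y0 y1].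
have [||z] := @has_der_MVT _ x y (uxx^~ t) (uxxx^~ t) xy.
- exact: within_segmentS (cont_rect_slice uxx_cont tt).
- move=> z; rewrite in_itv /= => /andP[xz zy]; apply: has_der_sub (uxx_der _ tt).
    move=> v /=; rewrite !in_itv /= => /andP[h1 h2].
    by rewrite (le_trans x0 (ltW h1)) (le_trans (ltW h2)).
  by rewrite in_itv /= (le_trans x0 (ltW xz)) (le_trans (ltW zy)).
rewrite in_itv /= => /andP[xz zy] ->; rewrite normrM ler_wpM2r // uxxx_le //.
by rewrite in_itv /= (le_lt_trans x0 xz) (lt_le_trans zy).
Qed.

(** Comparison of [ut] at an end of a segment with its mean over the segment; the
    integral of [ut], which equals [uxx], is the increment of [ux]. *)
Lemma ut_mean a b t z : t \in `[0, T] -> 0 <= a -> a < b -> b <= 1 ->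
  z = a \/ z = b ->
  `|ut z t * (b - a) - (ux b t - ux a t)| <= K t * (b - a) ^+ 2 / 2.
Proof.
move=> tt a0 ab b1 zab.
have abW := ltW ab.
have zz : z \in `[0, 1] by rewrite in_itv /=; case: zab => ->; lra.
have Ii := primitive_has_int 1 0 (ut_primitive tt) a0 abW b1.
have {}Ii := has_intB (has_int_cst (ut z t) abW) Ii.
rewrite mul1r mul0r addr0 in Ii.
have lin (k c : R) : has_int (fun x => k * (x - c)) a b
    (k * ((b - c) ^+ 2 / 2) - k * ((a - c) ^+ 2 / 2)).
  apply: (@has_int_ftc _ _ (fun x => k * ((x - c) ^+ 2 / 2))) => //.
  - apply: (@has_der_segment_continuous _ a b _ (fun=> k * (1 - 0))) => x _.
    exact: has_derZ (has_derB (has_der_id _ _) (has_der_cst _ _ _)).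
  - apply: (@has_der_segment_continuous _ a b _ (fun x => k * (x - c))) => x _.
    apply: has_derZ.
    have d1 := has_derB (has_der_id `[a, b] x) (has_der_cst `[a, b] c x).
    have := has_derZ (2^-1) (has_derM d1 d1).
    have -> : 2^-1 * ((1 - 0) * (x - c) + (x - c) * (1 - 0)) = x - c by field.
    by apply: has_der_ext => y; rewrite -expr2 mulrC.
  - move=> x _; apply: has_derZ.
    have d1 := has_derB (has_der_id `]a, b[ x) (has_der_cst `]a, b[ c x).
    have := has_derZ (2^-1) (has_derM d1 d1).
    have -> : 2^-1 * ((1 - 0) * (x - c) + (x - c) * (1 - 0)) = x - c by field.
    by apply: has_der_ext => y; rewrite -expr2 mulrC.
have bound : exists2 g, has_int g a b (K t * (b - a) ^+ 2 / 2) &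
    forall x, x \in `]a, b[ -> g x = K t * `|z - x|.
  case: zab => ->.
    exists (fun x => K t * (x - a)).
      by have := lin (K t) a; congr has_int; field.
    by move=> x; rewrite in_itv /= => /andP[ax _]; rewrite distrC gtr0_norm ?subr_gt0.
  exists (fun x => - K t * (x - b)).
    by have := lin (- K t) b; congr has_int; field.
  move=> x; rewrite in_itv /= => /andP[_ xb]; rewrite gtr0_norm ?subr_gt0 //; ring.
case: bound => g gi gE.
have key x : x \in `]a, b[ -> `|ut z t - (1 * ut x t + 0)| <= g x.
  move=> xab; rewrite gE // mul1r addr0; apply: ut_lipschitz => //.
  by move: xab; rewrite !in_itv /=; lra.
rewrite ler_norml; apply/andP; split.
  rewrite -mulN1r; apply: has_int_le (has_intZ (-1) gi) Ii _ => x /key.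
  by rewrite ler_norml mulN1r => /andP[].
by apply: has_int_le Ii gi _ => x /key; rewrite ler_norml => /andP[].
Qed.

End HeatSolution.

(** * Summation by parts over the faces *)

Section DiscreteIdentities.
Context {R : realFieldType}.
Implicit Types (a b p v s Q U l : nat -> R) (n : nat).

Lemma sum_by_parts a b n :
  \sum_(0 <= i < n.+1) a i * (b i.+1 - b i) =
  a n * b n.+1 - a 0%N * b 0%N - \sum_(0 <= i < n) (a i.+1 - a i) * b i.+1.
Proof.
elim: n => [|n IH]; first by rewrite big_nat1 big_geq // subr0 mulrBr.
by rewrite big_nat_recr //= IH big_nat_recr //=; ring.
Qed.

(** The dissipation identity, for the faces 0, .., n of slopes [p], velocities
    [v], lengths [l] and corner speeds [s]; [Q] and [U] are the values at the
    corners of the space derivative and of the time derivative. *)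
Lemma crystalline_dissipation p v s Q U l n :
  s 0%N = 0 -> s n.+1 = 0 -> U 0%N = 0 -> U n.+1 = 0 -> v 0%N = 0 -> v n = 0 ->
  (forall i, (i < n)%N -> s i.+1 * (p i.+1 - p i) = - (v i.+1 - v i)) ->
  (forall i, (i.+1 < n)%N -> 2 * v i.+1 * l i.+1 = p i.+2 - p i) ->
  \sum_(0 <= i < n.+1) (- 2 * p i *
      ((Q i.+1 * s i.+1 + U i.+1) - (Q i * s i + U i)) +
      p i ^+ 2 * (s i.+1 - s i)) =
  2 * (\sum_(0 <= i < n.+1) v i * (Q i.+1 - Q i) -
       \sum_(0 <= i < n.+1) v i ^+ 2 * l i +
       \sum_(0 <= i < n) (p i.+1 - p i) * U i.+1).
Proof.
move=> s0 sn U0 Un v0 vn sE vE; rewrite big_split /=.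
rewrite (eq_bigr (fun i => (-2) * p i * ((fun j => Q j * s j + U j) i.+1 -
  (fun j => Q j * s j + U j) i))) // !sum_by_parts.
rewrite s0 sn U0 Un v0 vn !mulr0 !addr0 !mulr0 !mul0r.
have curv : \sum_(0 <= i < n) (p i.+1 + p i) * (v i.+1 - v i) =
    - 2 * \sum_(0 <= i < n.+1) v i ^+ 2 * l i.
  case: n vn vE {sn Un sE} => [|k] vk vE.
    by rewrite big_geq // big_nat1 v0 expr2 !mul0r mulr0.
  rewrite (eq_bigr (fun i => (p i.+1 + p i) * v i.+1 - (p i.+1 + p i) * v i)); last first.
    by move=> i _; rewrite mulrBr.
  rewrite sumrB big_nat_recr //= vk mulr0 addr0.
  rewrite [X in _ - X]big_nat_recl //= v0 mulr0 add0r -sumrB.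
  rewrite big_nat_recl // big_nat_recr //= vk v0 expr2 !mul0r add0r addr0.
  rewrite mulr_sumr; apply: eq_big_nat => i /= ik.
  have -> : -2 * (v i.+1 ^+ 2 * l i.+1) = - v i.+1 * (2 * v i.+1 * l i.+1) by ring.
  by rewrite vE //; ring.
set A1 := \sum_(0 <= i < n) _; set A2 := \sum_(0 <= i < n) _.
set B1 := \sum_(0 <= i < n) _; set D := \sum_(0 <= i < n) (p i.+1 - p i) * U i.+1.
set C := \sum_(0 <= i < n) (p i.+1 + p i) * _ in curv.
suff : A1 + A2 + C + 2 * D = 2 * B1 by move: curv; lra.
rewrite !mulr_sumr -!big_split /=; apply: eq_big_nat => i /= ni.
have h := sE i ni.
have -> : (p i.+1 ^+ 2 - p i ^+ 2) * s i.+1 =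
  (p i.+1 + p i) * (s i.+1 * (p i.+1 - p i)) by ring.
have -> : (-2 * p i.+1 - -2 * p i) * (Q i.+1 * s i.+1 + U i.+1) =
  - 2 * Q i.+1 * (s i.+1 * (p i.+1 - p i)) - 2 * (p i.+1 - p i) * U i.+1 by ring.
by rewrite h; ring.
Qed.

(** The quadrature error: interior faces contribute the mean of [U] over the
    face, and the two extreme ones the boundary value zero. *)
Lemma crystalline_error p v Q U l (m K : R) n :
  0 <= m -> 0 <= K -> v 0%N = 0 -> v n = 0 ->
  (forall i, (i <= n)%N -> 0 < l i) ->
  (forall i, (i.+1 < n)%N -> 2 * v i.+1 * l i.+1 = p i.+2 - p i) ->
  (forall i, (i < n)%N -> `|p i.+1 - p i| <= m) ->
  ((0 < n)%N -> `|U 1%N| <= K * l 0%N /\ `|U n| <= K * l n) ->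
  (forall i j, (i.+1 < n)%N -> j = i.+1 \/ j = i.+2 ->
     `|U j * l i.+1 - (Q i.+2 - Q i.+1)| <= K * l i.+1 ^+ 2 / 2) ->
  \sum_(0 <= i < n) (p i.+1 - p i) * U i.+1 -
    \sum_(0 <= i < n.+1) v i * (Q i.+1 - Q i) <=
  2^-1 * m * K * \sum_(0 <= i < n.+1) l i.
Proof.
move=> m0 K0 v0 vn l0 vE pm Ub Ui.
case: n vn l0 vE pm Ub Ui => [|k] vk l0 vE pm Ub Ui.
  rewrite big_geq // !big_nat1 v0 mul0r subr0.
  by rewrite !mulr_ge0 // ?invr_ge0 // ltW // l0.
have {Ub}[//|Ub1 Ub2] := Ub.
pose A i := (Q i.+2 - Q i.+1) / l i.+1.
have UA i j : (i < k)%N -> j = i.+1 \/ j = i.+2 -> `|U j - A i| <= K * l i.+1 / 2.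
  move=> ik ij; have li := l0 i.+1 (leqW ik).
  have := Ui i j ik ij.
  have -> : U j * l i.+1 - (Q i.+2 - Q i.+1) = (U j - A i) * l i.+1.
    by rewrite /A mulrBl divfK // gt_eqF.
  rewrite normrM (gtr0_norm li).
  have -> : K * l i.+1 ^+ 2 / 2 = K * l i.+1 / 2 * l i.+1 by ring.
  by rewrite ler_pM2r.
have -> : \sum_(0 <= i < k.+2) v i * (Q i.+1 - Q i) =
    \sum_(0 <= i < k) ((p i.+1 - p i) + (p i.+2 - p i.+1)) / 2 * A i.
  rewrite big_nat_recl // big_nat_recr //= v0 vk !mul0r add0r addr0.
  apply: eq_big_nat => i /= ik.
  have li := l0 i.+1 (leqW ik).
  have -> : p i.+1 - p i + (p i.+2 - p i.+1) = 2 * v i.+1 * l i.+1.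
    by rewrite vE //; ring.
  by rewrite /A; field; rewrite gt_eqF.
have -> : \sum_(0 <= i < k.+1) (p i.+1 - p i) * U i.+1 =
    2^-1 * (\sum_(0 <= i < k) (p i.+1 - p i) * U i.+1 + (p k.+1 - p k) * U k.+1) +
    2^-1 * ((p 1%N - p 0%N) * U 1%N + \sum_(0 <= i < k) (p i.+2 - p i.+1) * U i.+2).
  rewrite -(big_nat_recr k) // -(big_nat_recl k 0 (fun i => (p i.+1 - p i) * U i.+1)) //=.
  by field.
have -> : \sum_(0 <= i < k.+2) l i = l 0%N + l k.+1 + \sum_(0 <= i < k) l i.+1.
  by rewrite big_nat_recl // big_nat_recr //=; ring.
have bnd (x y c : R) : `|x| <= m -> `|y| <= c -> x * y <= m * c.
  by move=> xm yc; rewrite (le_trans (ler_norm _)) // normrM ler_pM.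
have h1 := bnd _ _ _ (pm 0%N isT) Ub1.
have h2 := bnd _ _ _ (pm k (ltnSn k)) Ub2.
have h3 : \sum_(0 <= i < k) ((p i.+1 - p i) * (U i.+1 - A i) +
     (p i.+2 - p i.+1) * (U i.+2 - A i)) <= \sum_(0 <= i < k) m * K * l i.+1.
  rewrite !big_mkord; apply: ler_sum => i _.
  have a1 := bnd _ _ _ (pm i (leqW (ltn_ord i))) (UA i i.+1 (ltn_ord i) (or_introl erefl)).
  have a2 := bnd _ _ _ (pm i.+1 (ltn_ord i)) (UA i i.+2 (ltn_ord i) (or_intror erefl)).
  have -> : m * K * l i.+1 = m * (K * l i.+1 / 2) + m * (K * l i.+1 / 2) by field.
  exact: lerD.
have h4 : \sum_(0 <= i < k) ((p i.+1 - p i) * (U i.+1 - A i) +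
     (p i.+2 - p i.+1) * (U i.+2 - A i)) =
   \sum_(0 <= i < k) (p i.+1 - p i) * U i.+1 +
   \sum_(0 <= i < k) (p i.+2 - p i.+1) * U i.+2 -
   2 * \sum_(0 <= i < k) ((p i.+1 - p i) + (p i.+2 - p i.+1)) / 2 * A i.
  rewrite mulr_sumr -big_split -sumrB; apply: eq_bigr => i _ /=; by field.
rewrite -mulr_sumr in h3; rewrite h4 in h3.
by move: h1 h2 h3; lra.
Qed.

End DiscreteIdentities.

(** * The energy of the difference during one phase *)

Lemma cvg_nat_sum (R : realType) (F : set_system R) {FF : Filter F} n
    (f : nat -> R -> R) (L : nat -> R) :
  (forall i, (i < n)%N -> f i s @[s --> F] --> L i) ->
  \sum_(0 <= i < n) f i s @[s --> F] --> \sum_(0 <= i < n) L i.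
Proof.
elim: n => [_|n IH fL].
  have -> : (fun s => \sum_(0 <= i < 0) f i s) = (fun=> 0).
    by apply/funext => s; rewrite big_geq.
  by rewrite big_geq //; exact: cvg_cst.
have -> : (fun s => \sum_(0 <= i < n.+1) f i s) =
    (fun s => \sum_(0 <= i < n) f i s + f n s).
  by apply/funext => s; rewrite big_nat_recr.
rewrite big_nat_recr //=; apply: cvgD; last exact: fL.
by apply: IH => i ni; exact/fL/ltnW.
Qed.

Section ClosedMotion.
Context {R : realType}.
Variables (S : set R) (w : R -> R -> R) (t0 t1 : R) (c : R -> faces R).
Hypothesis mv : moves S w t0 t1 c.
Hypothesis t01 : t0 < t1.
Implicit Types (t s x : R) (i : nat).

Let N := size (c t0).

Lemma moves_corner_itv s i : s \in `[t0, t1] -> (i <= N)%N ->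
  corner (c s) i \in `[0, 1].
Proof.
move=> ss iN.
have H r : r \in `[t0, t1[ -> corner (c r) i \in `[0, 1].
  move=> rr; apply: (corner_itv (moves_has_faces mv rr)).
  by rewrite (moves_size mv (subset_itv_co_cc rr)).
have [s1|s1] := eqVneq s t1; last first.
  by apply: H; move: ss; rewrite !in_itv /= lt_neqAle s1.
rewrite s1 in_itv /=; apply/andP; split.
  apply: (within_closed_ge t01 (moves_corner_continuous mv i)) => r /H.
  by rewrite in_itv /= => /andP[].
rewrite -subr_ge0; apply: (within_closed_ge (f := fun r => 1 - corner (c r) i) t01).
  apply/within_segmentP => r rr.
  have cc := (within_segmentP _ _ _).1 (moves_corner_continuous mv i) r rr.
  exact: cvgB (cvg_cst _) cc.
by move=> r /H; rewrite in_itv /= subr_ge0 => /andP[].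
Qed.

Let vel i s := if (0 < i)%N && (i.+1 < N)%N
  then (slope (c t0) i.+1 - slope (c t0) i.-1) / (2 * len (c s) i) else 0.

Let velE s i : s \in `[t0, t1] -> velocity (c s) i = vel i s.
Proof. by move=> ss; rewrite /velocity (moves_size mv ss) !(moves_slope mv _ ss). Qed.

Let vel_cvg t i : t \in `[t0, t1] -> has_faces S (w^~ t) (c t) ->
  vel i s @[s --> within `[t0, t1] (nbhs t)] --> vel i t.
Proof.
move=> tt [lpos _ _]; rewrite /vel; case: ifP => [/andP[i0 iN]|_]; last exact: cvg_cst.
have li : len (c t) i != 0.
  by rewrite gt_eqF //; apply: (lpos i _).1; rewrite (moves_size mv tt) ltnW.
have lc := (within_segmentP _ _ _).1 (moves_len_continuous mv i) t tt.
apply: cvgM; first exact: cvg_cst.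
apply: cvgV; first by rewrite mulf_neq0 // pnatr_eq0.
exact: cvgM (cvg_cst _) lc.
Qed.

(** The law of motion of the corners holds up to the ends of the time interval,
    as long as no face has length zero. *)
Lemma moves_corner_der_closed t i : t \in `[t0, t1] ->
  has_faces S (w^~ t) (c t) -> (i <= N)%N ->
  has_der `[t0, t1] (fun s => corner (c s) i) t (corner_speed (c t) i).
Proof.
move=> tt tf iN.
pose G s := - ((vel i s - vel i.-1 s) / (slope (c t0) i - slope (c t0) i.-1)).
have GE s : s \in `[t0, t1] -> corner_speed (c s) i = G s.
  by move=> ss; rewrite /corner_speed !(velE _ ss) !(moves_slope mv _ ss).
rewrite GE //; apply: has_der_closure => //.
- exact: (moves_corner_continuous mv i).
- apply: filterE => s ss; rewrite -(GE s (subset_itv_oo_cc ss)).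
  exact: (moves_corner_der mv _ ss iN).
- have v1 := @vel_cvg t i tt tf; have v2 := @vel_cvg t i.-1 tt tf.
  exact: cvgN (cvgM (cvgB v1 v2) (cvg_cst _)).
Qed.

Lemma moves_face_der_closed t i x : t \in `[t0, t1] ->
  has_faces S (w^~ t) (c t) -> (i < N)%N ->
  {within `[t0, t1], continuous (w x)} ->
  x \in `]corner (c t) i, corner (c t) i.+1[ ->
  has_der `[t0, t1] (w x) t (velocity (c t) i).
Proof.
move=> tt tf iN wc; rewrite in_itv /= => /andP[x1 x2].
rewrite velE //; apply: has_der_closure => //; last exact: vel_cvg.
have c1 := (within_segmentP _ _ _).1 (moves_corner_continuous mv i) t tt.
have c2 := (within_segmentP _ _ _).1 (moves_corner_continuous mv i.+1) t tt.
have h1 : \forall s \near t, s \in `[t0, t1] -> corner (c s) i < x.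
  have H := cvgr_lt _ c1 _ x1; exact: H.
have h2 : \forall s \near t, s \in `[t0, t1] -> x < corner (c s) i.+1.
  have H := cvgr_gt _ c2 _ x2; exact: H.
apply: filterS2 h1 h2 => s h1 h2 ss; have sc := subset_itv_oo_cc ss.
rewrite -velE //; apply: is_derive_has_der.
case: mv => _ _ _ + _; apply => //; first by rewrite (moves_size mv sc).
by rewrite in_itv /= h1 // h2.
Qed.

End ClosedMotion.

Section EnergyBalance.
Context {R : realType}.
Variables (T : R) (u0 : R -> R) (u : R -> R -> R).
Hypotheses (T_gt0 : 0 < T) (u_C3 : Ck_rect T 3 u) (u_heat : heat_solution T u0 u).
Implicit Types (S : set R) (w : R -> R -> R) (c : faces R) (x t s : R).
Notation mu := (@lebesgue_measure R).
Notation ux := (dx u).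
Notation ut := (dt T u).
Notation K := (uxxx_norm u).

(** The part of the integral of [(ux - p) ^+ 2] over [x, y] that depends on [p]. *)
Definition face_cross t (p x y : R) : R :=
  - 2 * p * (u y t - u x t) + p ^+ 2 * (y - x).

Lemma face_cross_add t p x y z :
  face_cross t p x y + face_cross t p y z = face_cross t p x z.
Proof. by rewrite /face_cross; ring. Qed.

(** Twice the energy at time [t] of the difference of [u] and a profile with faces
    [c]; faces of length zero are allowed. *)
Definition faces_energy t c : R :=
  \int[mu]_(x in `[0, 1]) (ux x t ^+ 2) + face_sum (face_cross t) c.

Lemma faces_energy_remove t c : faces_energy t (remove_faces c) = faces_energy t c.
Proof. by rewrite /faces_energy (face_sum_remove (face_cross_add t)). Qed.

(** The function [g] is unconstrained at the corners. *)
Lemma slope_error_int S w t c (g : R -> R) : t \in `[0, T] ->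
  has_faces S (w^~ t) c ->
  (forall i x, (i < size c)%N -> x \in `]corner c i, corner c i.+1[ ->
    g x = ux x t - slope c i) ->
  has_int (fun x => `|g x| ^+ 2) 0 1 (faces_energy t c).
Proof.
move=> tt wc gE.
pose h x := `|g x| ^+ 2 - ux x t ^+ 2.
have := piecewise_has_int (f := h) (al := fun i => - 2 * slope c i)
  (be := fun i => slope c i ^+ 2) wc (ux_primitive u_C3 tt).
have hE i x : (i < size c)%N -> x \in `]corner c i, corner c i.+1[ ->
    h x = - 2 * slope c i * ux x t + slope c i ^+ 2.
  by move=> ic xi; rewrite /h real_normK ?num_real // (gE i) //; ring.
move=> /(_ hE) hi; rewrite /faces_energy.
have -> : face_sum (face_cross t) c = \sum_(0 <= i < size c)
   (- 2 * slope c i * (u (corner c i.+1) t - u (corner c i) t) +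
    slope c i ^+ 2 * len c i).
  by apply: eq_bigr => i _; rewrite /face_cross cornerS [_ + len c i]addrC addrK.
have := has_intD (ux2_int u_C3 tt) hi.
by apply: has_int_ext_oo => x _; rewrite /h [RHS]addrC subrK.
Qed.

Lemma dx_error_int S w t c : t \in `[0, T] -> has_faces S (w^~ t) c ->
  has_int (fun x => `|ux x t - dx w x t| ^+ 2) 0 1 (faces_energy t c).
Proof.
move=> tt wc; apply: (slope_error_int tt wc) => i x ic xi.
by rewrite /(dx w) (face_derive_in wc ic xi).
Qed.

Lemma energyE S w t c : t \in `[0, T] -> has_faces S (w^~ t) c ->
  energy u w t = 2^-1 * faces_energy t c.
Proof.
by move=> tt wc; rewrite /energy (has_int_Rintegral (dx_error_int tt wc)).
Qed.

Section Phase.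
Variables (S : set R) (w : R -> R -> R) (t0 t1 : R) (c : R -> faces R) (m : R).
Hypothesis mv : moves S w t0 t1 c.
Hypothesis t01 : t0 < t1.
Hypotheses (t0_ge0 : 0 <= t0) (t1_leT : t1 <= T) (m_ge0 : 0 <= m).
Hypothesis c_adj : slope_chain (Defs.adjacent S) (c t0).
Hypothesis c_jump : slope_chain (fun a b => `|b - a| <= m) (c t0).

Let N := size (c t0).

Let time_sub t : t \in `[t0, t1] -> t \in `[0, T].
Proof.
rewrite !in_itv /= => /andP[h1 h2].
by rewrite (le_trans t0_ge0 h1) (le_trans h2 t1_leT).
Qed.

Let dirichlet_cvg t : t \in `[t0, t1] ->
  has_der `[t0, t1] (fun s => \int[mu]_(x in `[0, 1]) (ux x s ^+ 2)) t
    (- 2 * \int[mu]_(x in `[0, 1]) (ut x t ^+ 2)).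
Proof.
move=> tt; apply: has_der_sub (dirichlet_der u_C3 u_heat (time_sub tt)).
by move=> s; exact: time_sub.
Qed.

Let energy_sumE s : s \in `[t0, t1] -> faces_energy s (c s) =
  \int[mu]_(x in `[0, 1]) (ux x s ^+ 2) + \sum_(0 <= i < N)
   (- 2 * slope (c t0) i * (u (corner (c s) i.+1) s - u (corner (c s) i) s) +
    slope (c t0) i ^+ 2 * (corner (c s) i.+1 - corner (c s) i)).
Proof.
move=> ss; rewrite /faces_energy /face_sum (moves_size mv ss).
congr (_ + _); apply: eq_bigr => i _.
by rewrite (moves_slope mv _ ss).
Qed.

Lemma faces_energy_continuous :
  {within `[t0, t1], continuous (fun s => faces_energy s (c s))}.
Proof.
apply/within_segmentP => t tt.
suff H : (\int[mu]_(x in `[0, 1]) (ux x s ^+ 2) + \sum_(0 <= i < N)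
   (- 2 * slope (c t0) i * (u (corner (c s) i.+1) s - u (corner (c s) i) s) +
    slope (c t0) i ^+ 2 * (corner (c s) i.+1 - corner (c s) i)))
    @[s --> within `[t0, t1] (nbhs t)] --> faces_energy t (c t).
  apply: cvg_trans H; apply: near_eq_cvg; rewrite near_withinE.
  by apply: filterE => s ss; rewrite energy_sumE.
rewrite energy_sumE //.
have dc := has_der_continuous (dirichlet_cvg tt).
have cc i := (within_segmentP _ _ _).1 (moves_corner_continuous mv i) t tt.
have uc i : (i <= N)%N -> u (corner (c s) i) s @[s --> within `[t0, t1] (nbhs t)] -->
    u (corner (c t) i) t.
  move=> iN; apply/cvgrPdist_lt => e e0.
  have [d d0 dP] := u_cont u_C3 (moves_corner_itv mv t01 tt iN) (time_sub tt) e0.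
  rewrite near_withinE; have near_c : \forall s \near t, s \in `[t0, t1] ->
      `|corner (c t) i - corner (c s) i| < d.
    by have /cvgrPdist_lt /(_ d d0) := cc i.
  have near_t : \forall s \near t, `|t - s| < d.
    by apply/nbhs_ballP; exists d.
  apply: filterS2 near_t near_c => s st h ss; rewrite distrC; apply: dP.
  - exact: (moves_corner_itv mv t01 ss iN).
  - exact: time_sub.
  - by rewrite distrC h.
  - by rewrite distrC.
apply: cvgD => //; apply: cvg_nat_sum => i iN.
apply: cvgD; apply: cvgM (cvg_cst _) _; apply: cvgB; try exact: cc.
- exact: uc.
- exact: uc (ltnW iN).
Qed.

(** The integral of [(ut - w_t) ^+ 2] over [0, 1] at time [t], when the faces of
    [w] are [d] and move with their velocities. *)
Definition dissipation t d : R :=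
  \int[mu]_(x in `[0, 1]) (ut x t ^+ 2) + \sum_(0 <= i < size d)
    (- 2 * velocity d i * (ux (corner d i.+1) t - ux (corner d i) t) +
     velocity d i ^+ 2 * len d i).

Lemma dissipation_int t d (f : R -> R) : t \in `[0, T] -> has_faces S (w^~ t) d ->
  (forall i x, (i < size d)%N -> x \in `]corner d i, corner d i.+1[ ->
    f x = velocity d i) ->
  has_int (fun x => `|ut x t - f x| ^+ 2) 0 1 (dissipation t d).
Proof.
move=> tt wd fE.
pose h x := `|ut x t - f x| ^+ 2 - ut x t ^+ 2.
have := piecewise_has_int (f := h) (al := fun i => - 2 * velocity d i)
  (be := fun i => velocity d i ^+ 2) wd (ut_primitive u_C3 u_heat tt).
have hE i x : (i < size d)%N -> x \in `]corner d i, corner d i.+1[ ->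
    h x = - 2 * velocity d i * ut x t + velocity d i ^+ 2.
  by move=> ic xi; rewrite /h real_normK ?num_real // (fE i) //; ring.
move=> /(_ hE) hi; have := has_intD (ut2_int u_C3 tt) hi.
by apply: has_int_ext_oo => x _; rewrite /h [RHS]addrC subrK.
Qed.

(** The time derivative of twice the energy, and its upper bound. *)
Lemma phase_energy_der t : t \in `[t0, t1] -> has_faces S (w^~ t) (c t) ->
  exists2 G, has_der `[t0, t1] (fun s => faces_energy s (c s)) t G &
    G <= 2 * (- dissipation t (c t) + 2^-1 * m * K t).
Proof.
move=> tt tf; have tT := time_sub tt.
have [lpos cN _] := tf; have sizeE := moves_size mv tt.
pose p i := slope (c t0) i; pose v i := velocity (c t) i.
pose sp i := corner_speed (c t) i; pose l i := len (c t) i.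
pose X i := corner (c t) i; pose Q i := ux (X i) t; pose U i := ut (X i) t.
have N0 : (0 < N)%N.
  have z01 : (0 : R) \in `[0, 1] by rewrite in_itv /= lexx ler01.
  by have [i + _] := exists_face tf z01; rewrite sizeE; exact: leq_ltn_trans.
pose n := N.-1; have NE : N = n.+1 by rewrite prednK.
have sizeN : size (c t) = n.+1 := etrans sizeE NE.
have X01 i : (i <= n.+1)%N -> X i \in `[0, 1].
  by move=> iN; apply: (moves_corner_itv mv t01 tt); rewrite -/N NE.
have l_gt0 i : (i <= n)%N -> 0 < l i.
  by move=> iN; apply: (lpos i _).1; rewrite sizeN ltnS.
have XS i : X i.+1 - X i = l i by rewrite /X cornerS addrC addKr.
exists (- 2 * \int[mu]_(x in `[0, 1]) (ut x t ^+ 2) + \sum_(0 <= i < n.+1)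
   (- 2 * p i * ((Q i.+1 * sp i.+1 + U i.+1) - (Q i * sp i + U i)) +
    p i ^+ 2 * (sp i.+1 - sp i))).
  have dX i : (i <= n.+1)%N -> has_der `[t0, t1] (fun s => corner (c s) i) t (sp i).
    by move=> iN; apply: (moves_corner_der_closed mv tt tf); rewrite -/N NE.
  have du i : (i <= n.+1)%N ->
      has_der `[t0, t1] (fun s => u (corner (c s) i) s) t (Q i * sp i + U i).
    move=> iN; apply: (@has_der_curve _ T _ u ux (fun s => corner (c s) i)).
    - exact: ux_cont u_C3.
    - by move=> x s xx ss; exact: (u_der u_C3 xx ss).
    - by move=> s; exact: time_sub.
    - exact: tt.
    - by move=> s ss; apply: (moves_corner_itv mv t01 ss); rewrite -/N NE.
    - exact: dX.
    - apply: (@has_der_sub _ `[0, T]); first by move=> s; exact: time_sub.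
      exact: (u_dert u_C3 (X01 i iN) tT).
  apply: has_der_eq (_ : has_der _ (fun s => \int[mu]_(x in `[0, 1]) (ux x s ^+ 2) +
     \sum_(0 <= i < n.+1) (- 2 * p i * (u (corner (c s) i.+1) s - u (corner (c s) i) s) +
     p i ^+ 2 * (corner (c s) i.+1 - corner (c s) i))) _ _).
  - by apply: filterE => s ss; rewrite energy_sumE // NE.
  - by rewrite energy_sumE // NE.
  - apply: has_derD; first exact: dirichlet_cvg.
    apply: has_der_sum => i iN.
    by apply: has_derD; apply: has_derZ; apply: has_derB;
      [exact: du|exact/du/ltnW|exact: dX|exact/dX/ltnW].
have pE i : slope (c t) i = p i by exact: (moves_slope mv i tt).
have v0 : v 0%N = 0 by rewrite /v /velocity.
have vn : v n = 0 by rewrite /v /velocity sizeN ltnn andbF.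
have [U0 U1] := ut_boundary T_gt0 u_heat tT.
have X0 : X 0%N = 0 by exact: corner0.
have Xn : X n.+1 = 1 by rewrite -cN sizeN.
have UX0 : U 0%N = 0 by rewrite /U X0.
have UXn : U n.+1 = 0 by rewrite /U Xn.
have vE i : (i.+1 < n)%N -> 2 * v i.+1 * l i.+1 = p i.+2 - p i.
  move=> ni; have li := l_gt0 i.+1 (ltnW ni).
  rewrite /v /velocity sizeN /= ltnS ni !pE -/(l _); field.
  by rewrite gt_eqF.
have sE i : (i < n)%N -> sp i.+1 * (p i.+1 - p i) = - (v i.+1 - v i).
  move=> ni; rewrite /sp /corner_speed !pE /= mulNr divfK // subr_eq0.
  by have [] := c_adj (i := i); rewrite -/N ?NE // eq_sym.
rewrite (@crystalline_dissipation _ p v sp Q U l n) //; last first.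
- by rewrite /sp -sizeN corner_speed_size.
- exact: corner_speed0.
have Ubound : (0 < n)%N -> `|U 1%N| <= K t * l 0%N /\ `|U n| <= K t * l n.
  move=> n0; split.
    have lip : `|U 1%N - U 0%N| <= K t * `|X 1%N - X 0%N| :=
      ut_lipschitz u_C3 u_heat (X01 0%N isT) (X01 1%N isT) tT.
    by rewrite UX0 subr0 XS (gtr0_norm (l_gt0 0%N isT)) in lip.
  have lip : `|U n - U n.+1| <= K t * `|X n - X n.+1| :=
    ut_lipschitz u_C3 u_heat (X01 n.+1 (leqnn _)) (X01 n (leqnSn _)) tT.
  by rewrite UXn subr0 (distrC (X n)) XS (gtr0_norm (l_gt0 n (leqnn n))) in lip.
have Umean i j : (i.+1 < n)%N -> j = i.+1 \/ j = i.+2 ->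
    `|U j * l i.+1 - (Q i.+2 - Q i.+1)| <= K t * l i.+1 ^+ 2 / 2.
  move=> ni ij; have := X01 i.+1 (leqW (ltnW ni)); have := X01 i.+2 (leqW ni).
  rewrite !in_itv /= => /andP[_ h1] /andP[h2 _].
  have h3 : X i.+1 < X i.+2 by rewrite -subr_gt0 XS l_gt0 // ltnW.
  rewrite -XS; apply: (ut_mean u_C3 u_heat tT h2 h3 h1).
  by case: ij => ->; [left|right].
have jump i : (i < n)%N -> `|p i.+1 - p i| <= m.
  by move=> ni; apply: c_jump; rewrite -/N NE.
have err := crystalline_error m_ge0 (uxxx_norm_ge0 u t) v0 vn l_gt0 vE jump Ubound Umean.
have lsum : \sum_(0 <= i < n.+1) l i = 1 by rewrite -sizeN -cN.
rewrite lsum mulr1 in err.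
rewrite /dissipation sizeN big_split /=.
have -> : \sum_(0 <= i < n.+1)
    - 2 * velocity (c t) i * (ux (corner (c t) i.+1) t - ux (corner (c t) i) t) =
    - 2 * \sum_(0 <= i < n.+1) v i * (Q i.+1 - Q i).
  by rewrite mulr_sumr; apply: eq_bigr => i _; rewrite -[LHS]mulrA.
rewrite -/(v _) -/(l _).
set A := \int[mu]_(x in _) _; set B := \sum_(0 <= i < n.+1) v i * _ in err *.
set D := \sum_(0 <= i < n) _ in err *; set C := \sum_(0 <= i < n.+1) _.
by move: (K t) err; clearbody A B C D => k err; lra.
Qed.

End Phase.
End EnergyBalance.

(** * The evolution across events *)

Lemma nonincreasing_der (R : realType) (a b : R) (f : R -> R) : a < b ->
  {within `[a, b], continuous f} ->
  (forall x, x \in `]a, b[ -> exists2 G, has_der `]a, b[ f x G & G <= 0) ->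
  f b <= f a.
Proof.
move=> ab fc fG.
have [f' f'P] : {f' : R -> R & forall x, x \in `]a, b[ ->
    has_der `]a, b[ f x (f' x) /\ f' x <= 0}.
  apply: (@choice _ _ (fun x y => x \in `]a, b[ -> has_der `]a, b[ f x y /\ y <= 0)).
  move=> x; have [/fG[G h1 h2]|nx] := boolP (x \in `]a, b[); first by exists G.
  by exists 0.
have [c cab E] := has_der_MVT ab fc (fun x xab => (f'P x xab).1).
rewrite -subr_le0 E mulr_le0_ge0 ?subr_ge0 ?(ltW ab) //.
by have [] := f'P c cab.
Qed.

Lemma has_int_faces_le (R : realType) (S : set R) (w f g : R -> R)
    (c : faces R) (v1 v2 : R) : has_faces S w c ->
  has_int f 0 1 v1 -> has_int g 0 1 v2 ->
  (forall i x, (i < size c)%N -> x \in `]corner c i, corner c i.+1[ -> f x <= g x) ->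
  v1 <= v2.
Proof.
move=> wc fv gv fg; have [_ c1 _] := wc; rewrite -c1 in fv gv.
suff H n : (n <= size c)%N -> forall a b, has_int f 0 (corner c n) a ->
    has_int g 0 (corner c n) b -> a <= b by exact: H _ (leqnn _) _ _ fv gv.
elim: n => [_ a b|n IH nc a b fa gb].
  rewrite corner0 => fa gb.
  by rewrite (has_int_uniq fa (has_int_pt f 0)) (has_int_uniq gb (has_int_pt g 0)).
have h0 : 0 <= corner c n by have := corner_itv wc (ltnW nc); rewrite in_itv /= => /andP[].
have h1 := ltW (corner_lt wc nc).
have [a1 [a2 [fa1 fa2 ->]]] := has_int_split h0 h1 fa.
have [b1 [b2 [gb1 gb2 ->]]] := has_int_split h0 h1 gb.
apply: lerD; first exact: IH (ltnW nc) _ _ fa1 gb1.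
by apply: has_int_le fa2 gb2 _ => x; exact: fg.
Qed.

Section Flow.
Context {R : realType}.
Variables (T : R) (u0 : R -> R) (u : R -> R -> R).
Hypotheses (T_gt0 : 0 < T) (u_C3 : Ck_rect T 3 u) (u_heat : heat_solution T u0 u).
Implicit Types (S : set R) (w : R -> R -> R) (x t s : R).
Notation mu := (@lebesgue_measure R).
Notation ux := (dx u).
Notation ut := (dt T u).
Notation K := (uxxx_norm u).

Let H t := \int[mu]_(s in `[0, t]) K s.

Let H_der t : t \in `[0, T] -> has_der `[0, T] H t (K t).
Proof. exact: integral_has_der T_gt0 (uxxx_norm_continuous u_C3). Qed.

Section FlowPhase.
Variables (S : set R) (w : R -> R -> R) (t0 t1 : R) (c : R -> faces R) (m : R).
Hypothesis mv : moves S w t0 t1 c.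
Hypothesis t01 : t0 < t1.
Hypotheses (t0_ge0 : 0 <= t0) (t1_leT : t1 <= T) (m_ge0 : 0 <= m).
Hypothesis w_cont : forall x, x \in `[0, 1] -> {within `[0, T], continuous (w x)}.
Hypothesis c_adj : slope_chain (Defs.adjacent S) (c t0).
Hypothesis c_jump : slope_chain (fun a b => `|b - a| <= m) (c t0).

Let sub t : t \in `[t0, t1] -> t \in `[0, T].
Proof.
rewrite !in_itv /= => /andP[h1 h2].
by rewrite (le_trans t0_ge0 h1) (le_trans h2 t1_leT).
Qed.

Lemma phase_energy_le t : t \in `[t0, t1] ->
  faces_energy u t (c t) <= faces_energy u t0 (c t0) + m * (H t - H t0).
Proof.
rewrite in_itv /= le_eqVlt => /andP[/predU1P[<- _|t0t tt1]].
  by rewrite subrr mulr0 addr0.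
have itv x : x \in `[t0, t] -> x \in `[t0, t1].
  by rewrite !in_itv /= => /andP[-> h]; rewrite (le_trans h).
have : faces_energy u t (c t) - m * H t <= faces_energy u t0 (c t0) - m * H t0.
  apply: (@nonincreasing_der _ t0 t (fun s => faces_energy u s (c s) - m * H s)) => //.
    apply/within_segmentP => s ss; apply: cvgB.
      have fe := faces_energy_continuous u_C3 u_heat mv t01 t0_ge0 t1_leT.
      apply: (within_segmentP _ _ _).1 s ss; apply: within_segmentS fe => //.
    apply: cvgM; first exact: cvg_cst.
    apply: has_der_continuous (has_der_sub _ (H_der (sub (itv s ss)))).
    by move=> r /itv; exact: sub.
  move=> s ss; have sc := subset_itv_oo_cc ss.
  have sco : s \in `[t0, t1[.
    by move: ss; rewrite !in_itv /= => /andP[/ltW -> h]; rewrite (lt_le_trans h).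
  have sf := moves_has_faces mv sco.
  have [G dG GL] := phase_energy_der T_gt0 u_C3 u_heat mv t01 t0_ge0 t1_leT m_ge0 c_adj c_jump (itv s sc) sf.
  exists (G - m * K s).
    apply: has_derB.
      by apply: has_der_sub dG => r /subset_itv_oo_cc /itv.
    apply/has_derZ/(has_der_sub _ (H_der (sub (itv s sc)))).
    by move=> r /subset_itv_oo_cc /itv; exact: sub.
  have d0 : 0 <= dissipation T u s (c s).
    have st : s \in `]t0, t1[.
      by move: ss; rewrite !in_itv /= => /andP[-> h]; rewrite (lt_le_trans h).
    have := dissipation_int (f := (dt T w)^~ s) u_C3 u_heat (sub (itv s sc)) sf.
    move=> /(_ _) /has_int_ge0; apply => [i x ic xi|x _]; last by rewrite exprn_ge0.
    apply: (has_der_derive_in T_gt0 (sub (itv s sc)) _).2.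
    by apply: is_derive_has_der; case: mv => _ _ _ h _; exact: h.
  by move: (K s) (dissipation _ _ _ _) d0 GL => k d d0 GL; lra.
by lra.
Qed.

(** The differential inequality at a time near which, within [0, T], the motion
    is that of the phase and no face has length zero. *)
Lemma phase_derivative t : t \in `[0, T] ->
  (\forall s \near t, s \in `[0, T] ->
     (s \in `[t0, t1]) /\ has_faces S (w^~ s) (c s)) ->
  derivable_in `[0, T] (energy u w) t /\
  derive_in `[0, T] (energy u w) t <=
    - (\int[mu]_(x in `[0, 1]) `|ut x t - dt T w x t| ^+ 2) + 2^-1 * m * K t.
Proof.
move=> tT near_ok; have [tt tf] := nbhs_singleton near_ok tT.
have [G dG GL] := phase_energy_der T_gt0 u_C3 u_heat mv t01 t0_ge0 t1_leT m_ge0 c_adj c_jump tt tf.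
have extend f l : has_der `[t0, t1] f t l -> has_der `[0, T] f t l.
  by apply: has_der_near; apply: filterS near_ok => s h /h[].
have dE : has_der `[0, T] (energy u w) t (2^-1 * G).
  apply: has_der_eq (has_derZ 2^-1 (extend _ _ dG)); last first.
    by rewrite (energyE u_C3 tT tf).
  by apply: filterS near_ok => s h ss; rewrite (energyE u_C3 ss (h ss).2).
have [dE1 ->] := has_der_derive_in T_gt0 tT dE; split=> //.
have := dissipation_int (f := (dt T w)^~ t) u_C3 u_heat tT tf.
move=> /(_ _) /has_int_Rintegral -> => [|i x ic xi].
  by move: (K t) (dissipation _ _ _ _) GL => k d GL; lra.
apply: (has_der_derive_in T_gt0 tT _).2; apply: extend.
have iN : (i < size (c t0))%N by rewrite -(moves_size mv tt).
have wx : {within `[t0, t1], continuous (w x)}.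
  apply: within_segmentS t0_ge0 t1_leT _; apply: w_cont.
  exact: face_sub tf ic (subset_itv_oo_cc xi).
exact: (moves_face_der_closed mv tt tf iN wx xi).
Qed.

(** The left boundary value does not move, since the first face has speed zero. *)
Lemma phase_boundary t : t \in `[t0, t1] -> w 0 t = w 0 t0.
Proof.
rewrite in_itv /= le_eqVlt => /andP[/predU1P[<- //|t0t] tt1].
have w0c : {within `[t0, t], continuous (w 0)}.
  apply: within_segmentS t0_ge0 (le_trans tt1 t1_leT) _; apply: w_cont.
  by rewrite in_itv /= lexx ler01.
suff dw s : s \in `]t0, t[ -> has_der `]t0, t[ (w 0) s 0.
  have [z _ E] := has_der_MVT t0t w0c dw.
  by apply/eqP; rewrite -subr_eq0 E mul0r.
move=> ss; have st : s \in `]t0, t1[.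
  by move: ss; rewrite !in_itv /= => /andP[-> h]; rewrite (lt_le_trans h).
have sf := moves_has_faces mv (subset_itv_oo_co st).
have scc := subset_itv_oo_cc st.
have N0 : (0 < size (c s))%N.
  have z01 : (0 : R) \in `[0, 1] by rewrite in_itv /= lexx ler01.
  by have [i + _] := exists_face sf z01; exact: leq_ltn_trans.
have l0 : 0 < len (c s) 0 by have [h _ _] := sf; exact: (h 0%N N0).1.
pose x := len (c s) 0 / 2.
have xl : x < len (c s) 0 by rewrite /x; lra.
have x0 : 0 < x by rewrite divr_gt0.
have w0E r : r \in `]t0, t1[ -> x < len (c r) 0 ->
    w x r + - slope (c t0) 0 * x = w 0 r.
  move=> rr xr; have rcc := subset_itv_oo_cc rr.
  have [_ _ waff] := moves_has_faces mv (subset_itv_oo_co rr).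
  have := waff 0%N 0 x; rewrite (moves_size mv rcc) -(moves_size mv scc) N0.
  rewrite !in_itv /= cornerS corner0 add0r (moves_slope mv _ rcc) lexx.
  rewrite (ltW x0) (ltW xr) (le_trans (ltW x0) (ltW xr)) subr0.
  by move=> /(_ isT isT isT) E; rewrite mulNr -E; ring.
have near_x : \forall r \near s, (r \in `]t0, t1[) /\ x < len (c r) 0.
  have lc := (within_segmentP _ _ _).1 (moves_len_continuous mv 0%N) s scc.
  have h1 : \forall r \near s, r \in `[t0, t1] -> x < len (c r) 0.
    have h := cvgr_gt _ lc _ xl; exact: h.
  have h2 := near_in_itvoo st.
  by apply: filterS2 h1 h2 => r h1 h2; split=> //; apply: h1; exact: subset_itv_oo_cc.
apply: (has_der_eq (f := fun r => w x r + - slope (c t0) 0 * x)).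
- by apply: filterS near_x => r [rr xr] _; exact: w0E.
- exact: w0E.
- rewrite -[X in has_der _ _ _ X]addr0; apply: has_derD (has_der_cst _ _ _).
  have -> : 0 = velocity (c s) 0 by [].
  apply: is_derive_has_der; case: mv => _ _ _ h _; apply: h => //.
  by rewrite in_itv /= cornerS corner0 add0r x0.
Qed.

End FlowPhase.

Lemma flow_le S w t0 c es : flow S T w t0 c es -> t0 <= T.
Proof. by elim=> // {}t0 t1 d l h _ _ _; apply: le_trans (ltW h). Qed.

Lemma flow_has_faces S w t0 c es : flow S T w t0 c es -> has_faces S (w^~ t0) c.
Proof.
case=> [{}t0 d t0T mv fT|{}t0 t1 d l t01 mv _ _].
  move: t0T; rewrite le_eqVlt => /predU1P[E|t0T]; first by rewrite {2}E E.
  by apply: (moves_has_faces mv); rewrite in_itv /= lexx.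
by apply: (moves_has_faces mv); rewrite in_itv /= lexx.
Qed.

Section FlowInduction.
Variables (S : set R) (w : R -> R -> R) (m : R).
Hypothesis m_ge0 : 0 <= m.
Hypothesis w_cont : forall x, x \in `[0, 1] -> {within `[0, T], continuous (w x)}.

Let good c := slope_chain (fun a b => Defs.adjacent S a b /\ `|b - a| <= m) c.

Let goodP c : good c -> slope_chain (Defs.adjacent S) c /\
  slope_chain (fun a b => `|b - a| <= m) c.
Proof. by move=> gc; split=> i /gc[]. Qed.

Let good_remove t0 t1 c : t0 < t1 -> moves S w t0 t1 c -> good (c t0) ->
  good (remove_faces (c t1)).
Proof.
move=> t01 mv gc; have [adj _] := goodP gc.
have t1cc : t1 \in `[t0, t1] by rewrite in_itv /= lexx ltW.
apply: remove_faces_chain (moves_zero_inflection mv t01 adj) => i.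
by rewrite (moves_size mv t1cc) !(moves_slope mv _ t1cc); exact: gc.
Qed.

(** Induction over the phases of the evolution. *)
Lemma flow_energy t0 c es : flow S T w t0 c es -> 0 <= t0 -> good c ->
  forall t, t \in `[t0, T] -> exists d,
  [/\ has_faces S (w^~ t) d,
      faces_energy u t d <= faces_energy u t0 c + m * (H t - H t0)
    & w 0 t = w 0 t0].
Proof.
elim=> {t0 c es} [t0 c t0T mv fT|t0 t1 c es t01 mv _ fl IH] t0_ge0 gc t tt.
  move: t0T; rewrite le_eqVlt => /predU1P[E|t0T].
    have -> : t = t0 by apply/eqP; rewrite eq_le; move: tt; rewrite in_itv /= -E andbC.
    exists (c t0); rewrite subrr mulr0 addr0; split=> //.
    by rewrite {2}E E.
  have [adj jmp] := goodP gc; exists (c t); split.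
  - have [->//|tT] := eqVneq t T; apply: (moves_has_faces mv).
    by move: tt; rewrite !in_itv /= => /andP[-> h]; rewrite lt_neqAle tT.
  - exact: (phase_energy_le mv t0T t0_ge0 (lexx T) m_ge0 adj jmp tt).
  - exact: (phase_boundary mv t0_ge0 (lexx T) w_cont tt).
have t1T := flow_le fl; have [adj jmp] := goodP gc.
have t1_ge0 := le_trans t0_ge0 (ltW t01).
have [tt1|t1t] := ltP t t1.
  have t01t : t \in `[t0, t1[ by move: tt; rewrite !in_itv /= tt1 => /andP[->].
  have tcc := subset_itv_co_cc t01t; exists (c t); split.
  - exact: (moves_has_faces mv t01t).
  - exact: (phase_energy_le mv t01 t0_ge0 t1T m_ge0 adj jmp tcc).
  - exact: (phase_boundary mv t0_ge0 t1T w_cont tcc).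
have t1cc : t1 \in `[t0, t1] by rewrite in_itv /= lexx ltW.
have [|d [df dE dw]] := IH t1_ge0 (good_remove t01 mv gc) t.
  by move: tt; rewrite !in_itv /= t1t => /andP[].
exists d; split=> //; last first.
  by rewrite dw; exact: (phase_boundary mv t0_ge0 t1T w_cont t1cc).
have := phase_energy_le mv t01 t0_ge0 t1T m_ge0 adj jmp t1cc.
rewrite faces_energy_remove in dE; move: dE.
by rewrite !mulrBr; lra.
Qed.

Lemma flow_derivative t0 c es : flow S T w t0 c es -> 0 <= t0 -> good c ->
  forall t, t \in `[t0, T] -> t0 = 0 \/ t0 < t -> t \notin es ->
  derivable_in `[0, T] (energy u w) t /\
  derive_in `[0, T] (energy u w) t <=
    - (\int[mu]_(x in `[0, 1]) `|ut x t - dt T w x t| ^+ 2) + 2^-1 * m * K t.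
Proof.
elim=> {t0 c es} [t0 c t0T mv fT|t0 t1 c es t01 mv _ fl IH] t0_ge0 gc t tt t0t tes.
  have [adj jmp] := goodP gc; move: (tt); rewrite in_itv /= => /andP[t0t' tT].
  have {}t0T : t0 < T by case: t0t => [-> //|h]; exact: lt_le_trans tT.
  have tT' : t \in `[0, T] by rewrite in_itv /= (le_trans t0_ge0).
  apply: (phase_derivative mv t0T) => //.
  have near_t0 : \forall s \near t, s \in `[0, T] -> t0 <= s.
    case: t0t => [->|h]; first by apply: filterE => s; rewrite in_itv /= => /andP[].
    by have := lt_nbhsr h; apply: filterS => s /ltW.
  apply: filterS near_t0 => s h ss; have t0s := h ss.
  have ssT : s \in `[t0, T] by move: ss; rewrite !in_itv /= t0s => /andP[].
  split=> //; have [->//|sT] := eqVneq s T; apply: (moves_has_faces mv).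
  by move: ssT; rewrite !in_itv /= lt_neqAle sT.
have t1T := flow_le fl; have [adj jmp] := goodP gc.
have t1_ge0 := le_trans t0_ge0 (ltW t01).
move: tes; rewrite inE negb_or => /andP[tne tes].
move: (tt); rewrite in_itv /= => /andP[t0t' tT].
have [tt1|t1t|E] := ltgtP t t1; last by rewrite E eqxx in tne.
  have tT' : t \in `[0, T] by rewrite in_itv /= (le_trans t0_ge0).
  apply: (phase_derivative mv t01) => //.
  have near_t0 : \forall s \near t, s \in `[0, T] -> t0 <= s.
    case: t0t => [->|h]; first by apply: filterE => s; rewrite in_itv /= => /andP[].
    by have := lt_nbhsr h; apply: filterS => s /ltW.
  have near_t1 := lt_nbhsl tt1.
  apply: filterS2 near_t0 near_t1 => s h st1 ss; have t0s := h ss.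
  split; first by rewrite in_itv /= t0s ltW.
  by apply: (moves_has_faces mv); rewrite in_itv /= t0s.
apply: IH => //; first exact: good_remove gc.
  by rewrite in_itv /= ltW.
by right.
Qed.

End FlowInduction.

End Flow.

(** * Initial energy and Sobolev norm *)

Section Consequences.
Context {R : realType}.
Variables (T : R) (u0 : R -> R) (u : R -> R -> R).
Hypotheses (T_gt0 : 0 < T) (u_C3 : Ck_rect T 3 u) (u_heat : heat_solution T u0 u).
Implicit Types (S : set R) (w : R -> R -> R) (x y t s : R) (d : faces R).
Notation mu := (@lebesgue_measure R).
Notation ux := (dx u).
Notation K := (uxxx_norm u).

Let zero_in_T : (0 : R) \in `[0, T]. Proof. by rewrite in_itv /= lexx ltW. Qed.

Lemma initial_slope x : x \in `[0, 1] -> derive_in `[0, 1] u0 x = ux x 0.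
Proof.
move=> xx; apply: (has_der_derive_in ltr01 xx _).2.
case: u_heat => _ ui _; apply: has_der_eq (u_der u_C3 xx zero_in_T).
  by apply: filterE => y yy; rewrite ui.
by rewrite ui.
Qed.

(** Off the corners the essential bound on the slopes holds pointwise. *)
Lemma initial_energy_le S w (v0 : R -> R) d m : has_faces S v0 d ->
  has_faces S (w^~ 0) d ->
  (Linf01 (fun x => derive_in `[0%R, 1%R] v0 x - derive_in `[0%R, 1%R] u0 x)%R
    <= m%:E)%E ->
  faces_energy u 0 d <= m ^+ 2.
Proof.
move=> v0d wd Lm.
have err := dx_error_int u_C3 zero_in_T wd.
have cst := has_int_cst (m ^+ 2) (@ler01 R); rewrite subr0 mulr1 in cst.
apply: (has_int_faces_le wd err cst) => i x id xi.
have x01 := face_sub_oo wd id xi.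
pose f y := derive_in `[0, 1] v0 y - derive_in `[0, 1] u0 y.
have fE y : y \in `]corner d i, corner d i.+1[ -> f y = slope d i - ux y 0.
  move=> yi; rewrite /f (face_derive_in v0d id yi) initial_slope //.
  exact: subset_itv_oo_cc (face_sub_oo wd id yi).
have fm : `|f x| <= m.
  apply: (le_Linf01 Lm x01); apply/cvgrPdist_lt => e e0; rewrite -/(f x).
  have := (within_segmentP _ _ _).1 (cont_rect_slice (ux_cont u_C3) zero_in_T) x
    (subset_itv_oo_cc x01).
  move=> /cvgrPdist_lt /(_ e e0) near_u.
  have {}near_u : \forall y \near x, y \in `[0, 1] -> `|ux x 0 - ux y 0| < e := near_u.
  have near_i := near_in_itvoo xi.
  apply: filterS2 near_u near_i => y h yi; rewrite -/(f y) (fE x xi) (fE y yi).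
  have -> : slope d i - ux x 0 - (slope d i - ux y 0) = - (ux x 0 - ux y 0) by ring.
  by rewrite normrN; apply: h; exact: subset_itv_oo_cc (face_sub_oo wd id yi).
rewrite /(dx w) (face_derive_in wd id xi) distrC -(fE x xi).
by rewrite lerXn2r // nnegrE // (le_trans _ fm).
Qed.

(** Poincare inequality for the difference of [u] and a profile, from
    [2 * l * z' - l ^+ 2 <= z' ^+ 2] with [l] the value [z y]. *)
Lemma pointwise_error S w d t y : t \in `[0, T] -> has_faces S (w^~ t) d ->
  w 0 t = 0 -> y \in `[0, 1] -> `|u y t - w y t| ^+ 2 <= faces_energy u t d.
Proof.
move=> tt wd w0 yy; move: (yy); rewrite in_itv /= => /andP[y0 y1].
have u00 : u 0 t = 0 by case: u_heat => _ _ ub; case: (ub t tt).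
have err := dx_error_int u_C3 tt wd.
have [v1 [v2 [h1 h2 ->]]] := has_int_split y0 y1 err.
have v20 : 0 <= v2 by apply: has_int_ge0 h2 _ => x _; rewrite exprn_ge0.
have := has_int_slope_defect wd (ux_primitive u_C3 tt) yy.
rewrite u00 w0 subrr subr0; set z := u y t - w y t => zi.
have zi2 := has_intB (has_intZ (2 * z) zi) (has_int_cst (z ^+ 2) y0).
have le1 : 2 * z * z - z ^+ 2 * (y - 0) <= v1.
  apply: has_int_le zi2 h1 _ => x _; rewrite real_normK ?num_real // /(dx w).
  by set q := ux x t - _; rewrite -subr_ge0; have := sqr_ge0 (q - z); rewrite sqrrB; lra.
rewrite real_normK ?num_real //.
have le2 : z ^+ 2 * y <= z ^+ 2 by rewrite ler_piMr ?sqr_ge0.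
by move: le1 le2 v20; rewrite expr2; clearbody z; lra.
Qed.

Lemma H1norm_error S w d t : t \in `[0, T] -> has_faces S (w^~ t) d ->
  w 0 t = 0 ->
  H1norm (fun x => u x t - w x t) <= Num.sqrt (2 * faces_energy u t d).
Proof.
move=> tt wd w0; rewrite /H1norm; apply: ler_wsqrtr.
have der_int := slope_error_int (g := derive_in `[0, 1] (fun x => u x t - w x t)) u_C3 tt wd.
rewrite (has_int_Rintegral (der_int _)); last first.
  move=> i x id xi; have xx := face_sub wd id (subset_itv_oo_cc xi).
  apply: (has_der_derive_in ltr01 xx _).2.
  exact: has_derB (u_der u_C3 xx tt) (face_has_der _ wd id xi).
rewrite (mulrDl 1 1) !mul1r lerD2r.
pose defect i x := u x t - (w (corner d i) t + slope d i * (x - corner d i)).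
pose V i := \int[mu]_(x in `[corner d i, corner d i.+1]) (defect i x * defect i x).
have piece i : (i < size d)%N ->
    has_int (fun x => `|u x t - w x t| ^+ 2) (corner d i) (corner d i.+1) (V i).
  move=> id; have lei := ltW (corner_lt wd id).
  have ui : {within `[corner d i, corner d i.+1], continuous (u^~ t)}.
    apply: within_segmentS (cont_rect_slice (u_cont u_C3) tt).
      by have := corner_itv wd (ltnW id); rewrite in_itv /= => /andP[].
    by have := corner_itv wd id; rewrite in_itv /= => /andP[].
  have defect_cont : {within `[corner d i, corner d i.+1],
      continuous (fun x => defect i x * defect i x)}.
    apply/within_segmentP => x xi.
    have uc := (within_segmentP _ _ _).1 ui x xi.
    have ac := has_der_continuous (has_derD (has_der_cst `[corner d i, corner d i.+1]
        (w (corner d i) t) x) (has_derZ (slope d i)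
        (has_derB (has_der_id _ _) (has_der_cst _ (corner d i) _)))).
    exact: (cvgM (cvgB uc ac) (cvgB uc ac)).
  apply: has_int_ext_oo (continuous_has_int lei defect_cont) => x xi.
  rewrite real_normK ?num_real // -expr2 /defect.
  have [_ _ waff] := wd; have := waff i (corner d i) x id.
  rewrite in_itv /= lexx lei => /(_ isT (subset_itv_oo_cc xi)) <-.
  by rewrite [w _ t + _]addrC subrK.
have zi := has_int_faces1 wd piece.
rewrite (has_int_Rintegral zi).
have cst := has_int_cst (faces_energy u t d) (@ler01 R); rewrite subr0 mulr1 in cst.
apply: has_int_le zi cst _ => x /subset_itv_oo_cc xx.
exact: pointwise_error tt wd w0 xx.
Qed.

End Consequences.

Theorem mainTheorem2 (R : realType) (T : R) (u0 : R -> R) (u : R -> R -> R)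
    (T_gt0 : 0 < T) (u_C3 : Ck_rect T 3 u) (u_heat : heat_solution T u0 u) :
  (forall (S : set R) (u0m : R -> R) (c0 : faces R) (um : R -> R -> R)
      (es : seq R),
    locally_finite_set S ->
    compatible S u0m c0 ->
    crystalline_evolution S T u0m c0 um es ->
    let m := max_jump c0 in
    (forall t, t \in `[0, T] -> t \notin es ->
      derivable_in `[0, T] (energy u um) t /\
      derive_in `[0, T] (energy u um) t <=
        - (\int[@lebesgue_measure R]_(x in `[0, 1])
             `|dt T u x t - dt T um x t| ^+ 2)
        + 2^-1 * m * uxxx_norm u t) /\
    ((Linf01 (fun x => derive_in `[0%R, 1%R] u0m x
                       - derive_in `[0%R, 1%R] u0 x)%R <= m%:E)%E ->
     forall t, t \in `[0, T] ->
      energy u um t <=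
        2^-1 * m ^+ 2
        + 2^-1 * m * \int[@lebesgue_measure R]_(s in `[0, t]) uxxx_norm u s)) /\
  (forall M : R, exists C : R,
    forall (S : set R) (u0m : R -> R) (c0 : faces R) (um : R -> R -> R)
      (es : seq R),
    locally_finite_set S ->
    compatible S u0m c0 ->
    crystalline_evolution S T u0m c0 um es ->
    let m := max_jump c0 in
    m <= M ->
    (Linf01 (fun x => derive_in `[0%R, 1%R] u0m x
                      - derive_in `[0%R, 1%R] u0 x)%R <= m%:E)%E ->
    (ereal_sup [set (H1norm (fun x => (u x t - um x t)%R))%:E |
                 t in `[0%R, T]] <= (C * Num.sqrt m)%:E)%E).
Proof.
pose H t := \int[@lebesgue_measure R]_(s in `[0, t]) uxxx_norm u s.
have H0 : H 0 = 0 by rewrite /H set_itv1 Rintegral_set1.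
have zT : (0 : R) \in `[0, T] by rewrite in_itv /= lexx ltW.
have facts (S : set R) (u0m : R -> R) c0 um es : compatible S u0m c0 ->
    crystalline_evolution S T u0m c0 um es ->
    slope_chain (fun a b => Defs.adjacent S a b /\ `|b - a| <= max_jump c0) c0 /\
    (forall t, t \in `[0, T] -> exists d, [/\ has_faces S (um^~ t) d,
       faces_energy u t d <= faces_energy u 0 c0 + max_jump c0 * H t
       & um 0 t = 0]).
  move=> [u0mf u0m0 _ adj] [um0 umc fl].
  have good : slope_chain (fun a b => Defs.adjacent S a b /\ `|b - a| <= max_jump c0) c0.
    by move=> i ic; split; [exact: adj|exact: max_jump_ub].
  split=> // t tt.
  have [d [df dE dw]] := flow_energy T_gt0 u_C3 u_heat (max_jump_ge0 c0) umc fl (lexx 0) good tt.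
  exists d; split=> //; first by rewrite -/(H t) -/(H 0) H0 subr0 in dE.
  by rewrite dw um0 ?u0m0 // in_itv /= lexx ler01.
have start (S : set R) (u0m : R -> R) c0 um es : compatible S u0m c0 ->
    crystalline_evolution S T u0m c0 um es ->
    (Linf01 (fun x => derive_in `[0%R, 1%R] u0m x - derive_in `[0%R, 1%R] u0 x)%R
      <= (max_jump c0)%:E)%E ->
    faces_energy u 0 c0 <= max_jump c0 ^+ 2.
  move=> [u0mf _ _ _] [_ _ /flow_has_faces fl].
  exact: (initial_energy_le T_gt0 u_C3 u_heat u0mf fl).
split.
  move=> S u0m c0 um es _ comp cryst m.
  have [good bound] := facts _ _ _ _ _ comp cryst; split.
    move=> t tt tes; case: cryst => _ umc fl.
    apply: (flow_derivative T_gt0 u_C3 u_heat (max_jump_ge0 c0) umc fl (lexx 0) good tt _ tes).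
    by left.
  move=> Lm t tt; have [d [df dE _]] := bound t tt.
  have := start _ _ _ _ _ comp cryst Lm.
  rewrite (energyE u_C3 tt df) -/(H t) -/m.
  by move: dE; rewrite -/m; move: (faces_energy u t d) (faces_energy u 0 c0) => a b; lra.
(* The square of the H1 norm is at most 2 * (m ^+ 2 + m * H T), and m <= M. *)
move=> M; exists (Num.sqrt (2 * (`|M| + H T))).
move=> S u0m c0 um es _ comp cryst m mM Lm.
have [_ bound] := facts _ _ _ _ _ comp cryst.
have e0 := start _ _ _ _ _ comp cryst Lm.
have m0 : 0 <= m := max_jump_ge0 c0.
have HT s : s \in `[0, T] -> 0 <= H s <= H T.
  rewrite in_itv /= => /andP[s0 sT].
  have Ki := continuous_has_int (le_trans s0 sT) (uxxx_norm_continuous u_C3).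
  have [v1 [v2 [h1 h2 E]]] := has_int_split s0 sT Ki.
  rewrite /H E (has_int_Rintegral h1) lerDl.
  by rewrite (has_int_ge0 h1) ?(has_int_ge0 h2) // => x _; exact: uxxx_norm_ge0.
apply: ge_ereal_sup => _ [t /= tt <-]; rewrite lee_fin.
have [d [df dE dw]] := bound t tt.
apply: le_trans (H1norm_error u_C3 u_heat tt df dw) _.
have /andP[Ht0 HtT] := HT t tt.
rewrite -sqrtrM; last by rewrite mulr_ge0 // addr_ge0 // (le_trans Ht0).
apply: ler_wsqrtr.
have h1 : m * m <= m * `|M| by rewrite ler_wpM2l // (le_trans mM) // ler_norm.
have h2 : m * H t <= m * H T by rewrite ler_wpM2l.
move: dE e0; rewrite -/m expr2; move: (faces_energy u t d) (faces_energy u 0 c0) => a b.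
by lra.
Qed.
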